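(* Let $n\ge 4$ and let $\mathbf u$ be a sequence of transpositions in $\mathrm{Sym}(n)$ whose transpositional multigraph $\mathcal T(\mathbf u)$ is a multitree on vertex set $n$. Then $\mathbf u$ is conjugacy invariant if and only if (1) no vertex of $\mathcal T(\mathbf u)$ lies on more than one non-simple multiedge, and (2) each multiedge of even multiplicity is a multitwig whose non-leaf vertex has exactly two neighbors.
   Context: $n=\{0,\ldots,n-1\}$; permutations compose left to right. For a finite sequence $\mathbf s$ in $\mathrm{Sym}(n)$, $\bigcirc\mathbf s$ is the composite of its terms in order, $\mathrm{Seq}(\mathbf s)$ its set of rearrangements and $\mathrm{Prod}(\mathbf s)=\{\bigcirc\mathbf r:\mathbf r\in\mathrm{Seq}(\mathbf s)\}$; $\mathbf s$ is conjugacy invariant iff every element of $\mathrm{Prod}(\mathbf s)$ is conjugate to $\bigcirc\mathbf s$. $\mathcal T(\mathbf u)$ is the multigraph on vertex set $n$ in which the multiedge $(x\,y)$ has multiplicity equal to the number of terms of $\mathbf u$ equal to $(x\,y)$; non-simple means multiplicity $\ge2$; neighbors are vertices joined by a multiedge of positive multiplicity. A multitree is a multigraph whose underlying simple graph is a tree. A multitwig is a multiedge $(v\,w)$ of positive multiplicity such that $v$ (its leaf) has exactly one neighbor; $w$ is its non-leaf vertex. *)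

(* Defs.v *)
From mathcomp Require Import all_boot all_fingroup.
Set Implicit Arguments.
Unset Strict Implicit.
Unset Printing Implicit Defensive.

(* The group law of 'S_n composes left to right: (s * t) x = t (s x). *)
Definition composite n (s : seq 'S_n) : 'S_n := (\prod_(p <- s) p)%g.

Definition Seq n (s r : seq 'S_n) : Prop := perm_eq r s.

Definition Prod n (s : seq 'S_n) (p : 'S_n) : Prop :=
  exists2 r, Seq s r & p = composite r.

Definition conjugate n (p q : 'S_n) : Prop := exists g : 'S_n, p = (q ^ g)%g.

Definition conjugacy_invariant n (s : seq 'S_n) : Prop :=
  forall p, Prod s p -> conjugate p (composite s).

Definition is_transposition n (p : 'S_n) : Prop :=
  exists x y : 'I_n, x != y /\ p = tperm x y.

(* A loopless multigraph on T is given by its multiplicity function, symmetric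
   and null on the diagonal; multiplicity 0 means that there is no multiedge. *)
Definition multigraph (T : finType) := T -> T -> nat.

Definition transpositional_multigraph n (u : seq 'S_n) : multigraph 'I_n :=
  fun x y => if x == y then 0 else count_mem (tperm x y) u.

Section Multigraph.
Variables (T : finType) (m : multigraph T).

Definition adjacent : rel T := fun x y => 0 < m x y.

Definition neighbors (x : T) : {set T} := [set y | adjacent x y].

Definition non_simple (x y : T) : bool := 2 <= m x y.

Definition multitwig (v w : T) : Prop := 0 < m v w /\ #|neighbors v| = 1.

End Multigraph.

(* For a symmetric irreflexive e; a ucycle of size 2 is an edge traversed back
   and forth, hence only those of size at least 3 are graph cycles. *)
Definition is_tree (T : finType) (e : rel T) : Prop :=
  [/\ 0 < #|T|, (forall x y, connect e x y)
    & (forall c : seq T, 2 < size c -> ~ ucycle e c)].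

Definition is_multitree (T : finType) (m : multigraph T) : Prop :=
  is_tree (adjacent m).

(* Main.v *)
(** The sum over all points of the size of their cycle is a conjugacy invariant,
    and multiplying by a transposition that joins two cycles of lengths [a] and
    [b] increases it by [2ab]. As the cycles of a product of edges lie inside
    the components of the graph they span and every edge of a tree is a bridge,
    this computes the invariant of well-chosen rearrangements, the others being
    obtained from [t * s * t = s ^ t], which moves an edge [s] adjacent to [t].
    Comparing these values forces (1) and (2).

    Conversely, let (1) and (2) hold. The copies of an even multiedge commute
    with every other term but one, so up to a cyclic rotation they cancel and
    the leaf is fixed. Then pairs of copies of an odd multiedge [t] are removed
    by conjugating by [t] the terms between them, which keeps the graph a tree
    because the edges at [t] are simple. What remains is a product of the edges
    of a simple tree on the surviving vertices [V], hence a cycle on [V], and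
    any two such cycles are conjugate. *)

Require Import Defs.
From mathcomp Require Import all_boot all_fingroup.
From mathcomp Require Import zify.
Set Implicit Arguments.
Unset Strict Implicit.
Unset Printing Implicit Defensive.

(** * Cycle lengths *)

Section Orbits.
Local Open Scope group_scope.
Variable T : finType.
Implicit Types (p q s t : {perm T}) (x y z : T).

Lemma porbit_invariant (X : Type) (f : T -> X) p x y :
  (forall z, f (p z) = f z) -> y \in porbit p x -> f y = f x.
Proof.
move=> fp /porbitP[i ->]; elim: i => [|i IHi]; first by rewrite perm1.
by rewrite expgSr permM fp.
Qed.

Lemma porbit_perm1 p x : porbit p (p x) = porbit p x.
Proof. by have := porbit_perm p 1 x; rewrite expg1. Qed.

Lemma porbit_conj p g x : porbit (p ^ g) (g x) = g @: porbit p x.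
Proof.
apply/setP=> y; apply/porbitP/imsetP => [[i ->]|[z /porbitP[i ->] ->]].
  by exists ((p ^+ i) x); rewrite ?mem_porbit // -conjXg permJ.
by exists i; rewrite -conjXg permJ.
Qed.

(** A cycle of length [c] contributes [c] for each of its points, so this is the sum of the squares
    of the cycle lengths. *)
Definition orbit_sum p := \sum_x #|porbit p x|.

Lemma orbit_sum_conj p g : orbit_sum (p ^ g) = orbit_sum p.
Proof.
rewrite /orbit_sum (reindex_inj (@perm_inj _ g)); apply: eq_bigr => x _.
by rewrite porbit_conj card_imset //; apply: perm_inj.
Qed.

(** Multiplying by [tperm x y] lowers the number of cycles by one. If [x] and [y] still had distinct
    cycles, a second multiplication would lower it again, yet it gives back [p]. *)
Lemma mem_porbit_tperm p x y :
  x \notin porbit p y -> x \in porbit (tperm x y * p) y.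
Proof.
move=> pxy; apply: contraT => npxy.
have := porbits_mul_tperm (tperm x y * p) x y.
have := porbits_mul_tperm p x y; rewrite /= tpermKg pxy npxy.
by case: (x != y); lia.
Qed.

Lemma porbit_tperm p x y z : x \notin porbit p y ->
  porbit (tperm x y * p) z =
    if z \in porbit p x :|: porbit p y then porbit p x :|: porbit p y
    else porbit p z.
Proof.
move=> pxy; set U := _ :|: _; set q := _ * p.
have Up w : (p w \in U) = (w \in U).
  by rewrite !inE -!eq_porbit_mem porbit_perm1.
have Ut w : (tperm x y w \in U) = (w \in U).
  by case: tpermP => // ->; rewrite !inE !porbit_id ?orbT.
(* The expected cycle of each point. As [f] is constant along [q], every cycle of [q] lies inside
   its value. *)
pose f w := if w \in U then U else porbit p w.
have fq w : f (q w) = f w.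
  rewrite /f permM Up Ut; case: ifP => // /negbT; rewrite -Ut => nUw.
  rewrite porbit_perm1; congr porbit; case: tpermP nUw => // ->.
    by rewrite !inE porbit_id orbT.
  by rewrite !inE porbit_id.
have pxy' := mem_porbit_tperm pxy.
(* Conversely, cycles of [q] are unions of cycles of [p]: [p w] is the image under [q] of
   [tperm x y w], a point in the [q]-cycle of [w]. *)
have Ep w : porbit q (p w) = porbit q w.
  apply/eqP; rewrite eq_porbit_mem.
  have qt v : p v \in porbit q (tperm x y v).
    by have := mem_porbit q 1 (tperm x y v); rewrite expg1 /q permM tpermK.
  have := qt w; case: tpermP => [->|->|//]; last rewrite porbit_sym => H.
    by move: pxy'; rewrite -!eq_porbit_mem => /eqP ->.
  by rewrite porbit_sym; move: H pxy'; rewrite -!eq_porbit_mem => /eqP <- /eqP ->.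
have sub v w : v \in porbit p w -> v \in porbit q w.
  by move=> /(porbit_invariant Ep) E; rewrite -eq_porbit_mem E.
rewrite -/(f z); apply/setP=> w; apply/idP/idP => [/(porbit_invariant fq) <-|].
  by rewrite /f; case: ifP => // _; rewrite porbit_id.
have UQ v : v \in U -> porbit q v = porbit q y.
  move: pxy'; rewrite -eq_porbit_mem => /eqP E.
  by rewrite inE => /orP[] /sub; rewrite -eq_porbit_mem => /eqP ->.
rewrite /f; case: ifP => [Uz Uw|_ /sub //].
by rewrite -eq_porbit_mem !UQ.
Qed.

Lemma card_porbit_tperm_in p x y z : x \notin porbit p y ->
    z \in porbit p x :|: porbit p y ->
  #|porbit (tperm x y * p) z| = (#|porbit p x| + #|porbit p y|)%N.
Proof.
move=> pxy Uz; rewrite porbit_tperm // Uz cardsU.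
suff -> : porbit p x :&: porbit p y = set0 by rewrite cards0 subn0.
apply/setP=> w; rewrite !inE; apply: contraNF pxy => /andP[].
by rewrite -!eq_porbit_mem => /eqP <-.
Qed.

(** Cycles of lengths [a] and [b] merge into one, and (a + b)^2 - a^2 - b^2 = 2ab. *)
Lemma orbit_sum_tperm p x y : x \notin porbit p y ->
  orbit_sum (tperm x y * p) =
    (orbit_sum p + 2 * (#|porbit p x| * #|porbit p y|))%N.
Proof.
move=> pxy; rewrite /orbit_sum.
pose U := porbit p x :|: porbit p y.
have dis : [disjoint porbit p x & porbit p y].
  rewrite -setI_eq0; apply: contraNT pxy => /set0Pn[w]; rewrite inE => /andP[].
  by rewrite -!eq_porbit_mem => /eqP <-.
rewrite (bigID [in U]) [X in _ = (X + _)%N](bigID [in U]) /=.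
under [X in (X + _)%N]eq_bigr => z Uz do rewrite (card_porbit_tperm_in pxy Uz).
under [X in (_ + X)%N = _]eq_bigr => z nUz do
  rewrite porbit_tperm // (negbTE nUz).
have cst w : \sum_(i in porbit p w) #|porbit p i| = (#|porbit p w| * #|porbit p w|)%N.
  rewrite -sum_nat_const; apply: eq_bigr => i.
  by rewrite -eq_porbit_mem => /eqP ->.
have bigUU F : \sum_(i in U) F i =
    (\sum_(i in porbit p x) F i + \sum_(i in porbit p y) F i)%N.
  by rewrite -bigU //; apply: eq_bigl => i; rewrite !inE.
rewrite !bigUU !cst !sum_nat_const; nia.
Qed.

Lemma porbit_tperm_out p x y z : x \notin porbit p y ->
  z \notin porbit p x -> z \notin porbit p y ->
  porbit (tperm x y * p) z = porbit p z.
Proof.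
by move=> pxy zx zy; rewrite porbit_tperm // inE (negbTE zx) (negbTE zy).
Qed.

End Orbits.

(** * The graph of a sequence of transpositions *)

Section Edges.
Local Open Scope group_scope.
Variable T : finType.
Implicit Types (p q s t : {perm T}) (a b v w x y z : T) (L R : seq {perm T}).

Definition transposition p := exists x y, x != y /\ p = tperm x y.

Definition edge L : rel T := fun x y => (x != y) && (tperm x y \in L).

Lemma edge_sym L : symmetric (edge L).
Proof. by move=> x y; rewrite /edge eq_sym tpermC. Qed.

Lemma edge_connect_sym L : connect_sym (edge L).
Proof. exact/sym_connect_sym/edge_sym. Qed.

Lemma edge_sub L R : {subset L <= R} ->
  forall x y, connect (edge L) x y -> connect (edge R) x y.
Proof.
move=> LR; apply: connect_sub => x y /andP[xy /LR xyR].
by apply: connect1; rewrite /edge xy.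
Qed.

Lemma connect_prod L x : {in L, forall p, transposition p} ->
  connect (edge L) x ((\prod_(p <- L) p) x).
Proof.
elim: L x => [|t L IHL] x tL; first by rewrite big_nil perm1.
rewrite big_cons permM; apply: (@connect_trans _ _ (t x)).
  have [a [b [ab ->]]] := tL t (mem_head _ _).
  case: tpermP => [->|->|_ _]; last exact: connect0.
    by apply: connect1; rewrite /edge ab mem_head.
  by apply: connect1; rewrite edge_sym /edge ab mem_head.
apply: edge_sub (IHL _ _) => [p Lp|p Lp]; first by rewrite inE Lp orbT.
by apply: tL; rewrite inE Lp orbT.
Qed.

(** Applying the product never leaves a component, so the [root] of the component is constant on
    cycles. *)
Lemma porbit_connect L x y : {in L, forall p, transposition p} ->
  y \in porbit (\prod_(p <- L) p) x -> connect (edge L) x y.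
Proof.
move=> tL /(porbit_invariant (f := root (edge L))) E; apply/(rootP (edge_connect_sym L)).
symmetry; apply: E => z; apply/esym/(rootP (edge_connect_sym L)).
exact: connect_prod.
Qed.

Lemma tperm_eq2 x y z : (tperm x y == tperm x z) = (y == z).
Proof.
by apply/eqP/eqP => [E|-> //]; rewrite -[y](tpermL x) E tpermL.
Qed.

Lemma tperm_neq x y z w : x != z -> x != w -> x != y -> tperm x y != tperm z w.
Proof.
move=> xz xw xy; apply/eqP=> E; move: (tpermL x y); rewrite E tpermD 1?eq_sym //.
by move=> Exy; rewrite Exy eqxx in xy.
Qed.

(* Conjugating by [w a] moves the end [w] of the edge [w b] to [a]. *)
Lemma tperm_slide w a b p : b != w -> b != a ->
  tperm w a * (tperm w b * (tperm w a * p)) = tperm a b * p.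
Proof.
move=> bw ba; have := tpermJ w b (tperm w a).
by rewrite /conjg tpermV tpermL tpermD 1?eq_sym // => <-; rewrite !mulgA.
Qed.

(** The product of the two transpositions is a 3-cycle; this is the relation (st)^3 = 1. *)
Lemma tperm_slide2 w a b p : a != w -> b != w -> b != a ->
  tperm w b * (tperm w a * (tperm w b * (tperm w a * (tperm w b * p)))) =
  tperm w a * p.
Proof.
move=> aw bw ba; rewrite (@tperm_slide w b a) //; last by rewrite eq_sym.
by rewrite (tpermC b) -(@tperm_slide w a b) // !tpermKg.
Qed.

Lemma tperm_square t : transposition t -> t * t = 1.
Proof. by case=> x [y [_ ->]]; rewrite tperm2. Qed.

End Edges.

(** * Rearrangements with constant orbit sum *)

Section OrbitSumInvariant.
Local Open Scope group_scope.
Variable T : finType.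
Implicit Types (p q s t : {perm T}) (a b v w x y z : T) (L R : seq {perm T}).

(** The consequence of conjugacy invariance on which necessity rests. It survives the removal of two
    equal transpositions, so multiplicities can be lowered within their parity. *)
Definition orbit_sum_invariant L :=
  forall R, perm_eq R L ->
  orbit_sum (\prod_(p <- R) p) = orbit_sum (\prod_(p <- L) p).

Lemma orbit_sum_invariant_perm L R :
  perm_eq L R -> orbit_sum_invariant L -> orbit_sum_invariant R.
Proof.
move=> LR invL r rR; rewrite [RHS]invL; last by rewrite perm_sym.
by apply: invL; rewrite (perm_trans rR) // perm_sym.
Qed.

Lemma orbit_sum_invariant_eq L R1 R2 : orbit_sum_invariant L ->
  perm_eq R1 L -> perm_eq R2 L ->
  orbit_sum (\prod_(p <- R1) p) = orbit_sum (\prod_(p <- R2) p).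
Proof. by move=> invL /invL -> /invL ->. Qed.

Lemma orbit_sum_invariant_cancel t L : transposition t ->
  orbit_sum_invariant (t :: t :: L) -> orbit_sum_invariant L.
Proof.
move=> /tperm_square tt inv R RL.
have := @inv (t :: t :: R); rewrite !perm_cons !big_cons !mulgA tt !mul1g.
exact.
Qed.

Lemma orbit_sum_invariant_nseq t j k L : transposition t ->
  j <= k -> odd j = odd k ->
  orbit_sum_invariant (nseq k t ++ L) -> orbit_sum_invariant (nseq j t ++ L).
Proof.
move=> tt; have [m] := ubnP k; elim: m k => // m IHm k km jk ojk inv.
have [->//|njk] := eqVneq j k.
case: k => [|[|k]] in km jk ojk njk inv *; [lia|by move: j jk ojk njk {IHm} => [|[|j]]|].
apply: (IHm k); [lia|lia|by rewrite ojk /= negbK|].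
exact: orbit_sum_invariant_cancel inv.
Qed.

Lemma perm_nseq_count t L :
  perm_eq L (nseq (count_mem t L) t ++ [seq s <- L | s != t]).
Proof.
apply/seq.permP=> P; rewrite count_cat count_nseq count_filter.
elim: L => [|s L /= ->]; first by rewrite muln0.
by case: eqVneq => [->|] /=; rewrite ?andbT ?andbF; lia.
Qed.

End OrbitSumInvariant.

Ltac perm_words := apply/seq.permP => ?; rewrite /= ?count_cat /=;
  repeat match goal with |- context [nat_of_bool ?b] =>
    generalize (nat_of_bool b) end;
  repeat match goal with |- context [@count ?A ?P ?L] => generalize (@count A P L) end;
  clear; intros; lia.

Ltac card_nia :=
  repeat match goal with |- context [@orbit_sum ?A ?p] =>
    generalize (@orbit_sum A p) end;
  repeat match goal with |- context [@card ?A ?P] => generalize (@card A P) end;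
  clear; intros; nia.

(** * Orbit sums of short words *)

Section Words.
Local Open Scope group_scope.
Variable T : finType.
Implicit Types (p q s t : {perm T}) (a b v w x y z : T) (L R : seq {perm T}).

Definition separated p := pairwise (fun x y => x \notin porbit p y).

Lemma card_porbit_gt0 p x : 0 < #|porbit p x|.
Proof. by rewrite lt0n card_porbit_neq0. Qed.

Lemma separated_neq p x y : x \notin porbit p y -> y != x.
Proof. by apply: contraNneq => ->; apply: porbit_id. Qed.

Lemma orbit_sum_lt_tperm p x y : x \notin porbit p y ->
  orbit_sum p < orbit_sum (tperm x y * p).
Proof.
move=> xy; rewrite orbit_sum_tperm //.
have := card_porbit_gt0 p x; have := card_porbit_gt0 p y; card_nia.
Qed.

(** Grouped copies cancel and leave the product of [L]. The alternating word leaves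
    [tperm a b * tperm w b] before it, which joins cycles twice and has a larger sum. *)
Lemma even_even_absurd w a b L :
    orbit_sum_invariant [:: tperm w a, tperm w a, tperm w b, tperm w b & L] ->
  ~~ separated (\prod_(p <- L) p) [:: w; a; b].
Proof.
move=> inv; apply/negP; rewrite /= !andbT => /andP[/andP[wa wb] ab].
have [[aw bw] ba] := (separated_neq wa, separated_neq wb, separated_neq ab).
have : orbit_sum (\prod_(p <-
      [:: tperm w a, tperm w a, tperm w b, tperm w b & L]) p) =
    orbit_sum (\prod_(p <-
      [:: tperm w a, tperm w b, tperm w a, tperm w b & L]) p).
  by apply: (orbit_sum_invariant_eq inv); perm_words.
rewrite !big_cons !tpermKg tperm_slide //.
move/eqP; rewrite ltn_eqF //; apply: ltn_trans (orbit_sum_lt_tperm wb) _.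
apply: orbit_sum_lt_tperm; rewrite porbit_tperm // inE porbit_id orbT inE.
by rewrite porbit_sym negb_or wa ab.
Qed.

(** The alternating word cancels completely, being the cube of a 3-cycle, while the grouped word
    leaves one copy of each edge and joins cycles twice. *)
Lemma odd_odd_absurd w a b L :
    orbit_sum_invariant [:: tperm w a, tperm w a, tperm w a,
                            tperm w b, tperm w b, tperm w b & L] ->
  ~~ separated (\prod_(p <- L) p) [:: w; a; b].
Proof.
move=> inv; apply/negP; rewrite /= !andbT => /andP[/andP[wa wb] ab].
have [[aw bw] ba] := (separated_neq wa, separated_neq wb, separated_neq ab).
have : orbit_sum (\prod_(p <-
      [:: tperm w a, tperm w b, tperm w a, tperm w b, tperm w a, tperm w b & L]) p) =
    orbit_sum (\prod_(p <-
      [:: tperm w a, tperm w a, tperm w a, tperm w b, tperm w b, tperm w b & L]) p).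
  by apply: (orbit_sum_invariant_eq inv); perm_words.
rewrite !big_cons !tpermKg tperm_slide // (@tperm_slide _ w b a) //; last first.
  by rewrite eq_sym.
rewrite (tpermC b) tpermKg.
move/eqP; rewrite ltn_eqF //; apply: ltn_trans (orbit_sum_lt_tperm wb) _.
apply: orbit_sum_lt_tperm; rewrite porbit_sym porbit_tperm // inE porbit_id inE.
by rewrite porbit_sym negb_or wa ab.
Qed.

(** Three arrangements reduce to the single edges [w b], [a b] and [w a]. Equal sums mean that the
    three pairwise products of the cycle lengths agree. *)
Lemma even_odd_card w a b L (p := \prod_(p <- L) p) :
    orbit_sum_invariant [:: tperm w a, tperm w a,
                            tperm w b, tperm w b, tperm w b & L] ->
    separated p [:: w; a; b] ->
  #|porbit p a| = #|porbit p w| /\ #|porbit p b| = #|porbit p w|.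
Proof.
move=> inv; rewrite /= !andbT => /andP[/andP[wa wb] ab].
have [[aw bw] ba] := (separated_neq wa, separated_neq wb, separated_neq ab).
have E1 : orbit_sum (\prod_(p <-
      [:: tperm w a, tperm w a, tperm w b, tperm w b, tperm w b & L]) p) =
    orbit_sum (\prod_(p <-
      [:: tperm w a, tperm w b, tperm w a, tperm w b, tperm w b & L]) p).
  by apply: (orbit_sum_invariant_eq inv); perm_words.
have E2 : orbit_sum (\prod_(p <-
      [:: tperm w a, tperm w b, tperm w a, tperm w b, tperm w b & L]) p) =
    orbit_sum (\prod_(p <-
      [:: tperm w b, tperm w a, tperm w b, tperm w a, tperm w b & L]) p).
  by apply: (orbit_sum_invariant_eq inv); perm_words.
move: E1 E2; rewrite !big_cons !tpermKg tperm_slide // tperm_slide2 // -/p.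
rewrite !orbit_sum_tperm //.
have := (card_porbit_gt0 p w, card_porbit_gt0 p a, card_porbit_gt0 p b).
case=> [[]]; card_nia.
Qed.

Lemma orbit_sum_star p x y z : separated p [:: x; y; z] ->
  orbit_sum (tperm x y * (tperm x z * p)) =
    (orbit_sum p + 2 * (#|porbit p x| * #|porbit p z|)
     + 2 * ((#|porbit p x| + #|porbit p z|) * #|porbit p y|))%N.
Proof.
rewrite /= !andbT => /andP[/andP[xy xz] yz].
have nyU : y \notin porbit p x :|: porbit p z.
  by rewrite inE negb_or yz porbit_sym xy.
rewrite orbit_sum_tperm; last first.
  by rewrite porbit_sym porbit_tperm // inE porbit_id.
rewrite orbit_sum_tperm // card_porbit_tperm_in //; last by rewrite inE porbit_id.
by rewrite porbit_tperm // (negbTE nyU).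
Qed.

Lemma orbit_sum_disjoint p x y z w : separated p [:: x; y; z; w] ->
  orbit_sum (tperm x y * (tperm z w * p)) =
    (orbit_sum p + 2 * (#|porbit p z| * #|porbit p w|)
     + 2 * (#|porbit p x| * #|porbit p y|))%N.
Proof.
rewrite /= !andbT => /and3P[/and3P[xy xz xw] /andP[yz yw] zw].
have E : porbit (tperm z w * p) x = porbit p x by rewrite porbit_tperm_out.
have E' : porbit (tperm z w * p) y = porbit p y by rewrite porbit_tperm_out.
by rewrite orbit_sum_tperm ?E ?E' // orbit_sum_tperm.
Qed.

(** The arrangements leave the edges [w b, w x], or [w b, a x], or [w a, w x]. The first and third
    give [a] and [b] equal cycle lengths, while the first two make the length at [a] the sum of
    those at [w] and [b]. *)
Lemma even_odd_third_absurd w a b x L :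
    orbit_sum_invariant [:: tperm w a, tperm w a,
                            tperm w b, tperm w b, tperm w b, tperm w x & L] ->
  ~~ separated (\prod_(p <- L) p) [:: w; a; b; x].
Proof.
move=> inv; apply/negP => /=; rewrite !andbT.
move=> /and3P[/and3P[wa wb wx] /andP[ab ax] bx].
have [[aw bw] ba] := (separated_neq wa, separated_neq wb, separated_neq ab).
have [[xw xa] xb] := (separated_neq wx, separated_neq ax, separated_neq bx).
have : orbit_sum (\prod_(p <-
      [:: tperm w a, tperm w a, tperm w b, tperm w b, tperm w b, tperm w x & L]) p) =
    orbit_sum (\prod_(p <-
      [:: tperm w b, tperm w b, tperm w b, tperm w a, tperm w x, tperm w a & L]) p).
  by apply: (orbit_sum_invariant_eq inv); perm_words.
have : orbit_sum (\prod_(p <-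
      [:: tperm w a, tperm w a, tperm w b, tperm w b, tperm w b, tperm w x & L]) p) =
    orbit_sum (\prod_(p <-
      [:: tperm w b, tperm w a, tperm w b, tperm w a, tperm w b, tperm w x & L]) p).
  by apply: (orbit_sum_invariant_eq inv); perm_words.
rewrite !big_cons !tpermKg tperm_slide2 // (@tperm_slide _ w a x) //.
set p := \prod_(i <- L) i in wa wb wx ab ax bx *.
rewrite !orbit_sum_star ?orbit_sum_disjoint //=; last first.
all: rewrite ?wa ?wb ?wx ?ab ?ax ?bx ?[b \in _]porbit_sym ?ab //.
have := (card_porbit_gt0 p w, card_porbit_gt0 p a,
         card_porbit_gt0 p b, card_porbit_gt0 p x).
case=> [[[]]]; card_nia.
Qed.

(* The path [a w b x] with the three edges doubled or tripled: the two even
   edges can be cancelled, or used to build the tree [ab], [wx], [wb]. *)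
Lemma even_odd_even_absurd a w b x L :
    orbit_sum_invariant [:: tperm w a, tperm w a,
                            tperm w b, tperm w b, tperm w b,
                            tperm b x, tperm b x & L] ->
  ~~ separated (\prod_(p <- L) p) [:: a; w; b; x].
Proof.
move=> inv; apply/negP => /=; rewrite !andbT.
move=> /and3P[/and3P[aw ab ax] /andP[wb wx] bx].
have [[wa ba] bw] := (separated_neq aw, separated_neq ab, separated_neq wb).
have [[xw xa] xb] := (separated_neq wx, separated_neq ax, separated_neq bx).
have : orbit_sum (\prod_(p <-
      [:: tperm w a, tperm w a, tperm w b, tperm w b, tperm w b, tperm b x, tperm b x & L]) p) =
    orbit_sum (\prod_(p <-
      [:: tperm w a, tperm w b, tperm w a, tperm b x, tperm b w, tperm b x, tperm w b & L]) p).
  by rewrite (tpermC b w); apply: (orbit_sum_invariant_eq inv); perm_words.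
rewrite !big_cons !tpermKg tperm_slide // (tpermC w b).
rewrite (@tperm_slide _ b x w) // 1?eq_sym //.
rewrite (tpermC b w); set p := \prod_(i <- L) i in aw ab ax wb wx bx *.
move/eqP; rewrite ltn_eqF //.
have Ew : porbit (tperm w b * p) w = porbit p w :|: porbit p b.
  by rewrite porbit_tperm // inE porbit_id.
have Ex : porbit (tperm w b * p) x = porbit p x.
  by rewrite porbit_tperm_out // porbit_sym.
have xw' : x \notin porbit (tperm w b * p) w.
  by rewrite Ew inE negb_or porbit_sym wx porbit_sym bx.
apply: ltn_trans (orbit_sum_lt_tperm xw') _.
apply: orbit_sum_lt_tperm; rewrite porbit_tperm // Ew Ex.
by rewrite !inE porbit_id !orbT !inE !negb_or ax aw ab.
Qed.

(** Enclosing [tperm w x] between the two copies of the even edge turns it into [tperm v x]. The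
    claim follows by equating both sums and dividing by the cycle length of [x]. *)
Lemma even_center_card v w x y L (p := \prod_(p <- L) p) :
    orbit_sum_invariant [:: tperm v w, tperm v w, tperm w x, tperm w y & L] ->
    separated p [:: v; w; x; y] ->
  #|porbit p v| = (#|porbit p w| + #|porbit p y|)%N.
Proof.
move=> inv sep; move: (sep) => /=; rewrite !andbT.
move=> /and3P[/and3P[vw vx vy] /andP[wx wy] xy].
have [[wv xv] xw] := (separated_neq vw, separated_neq vx, separated_neq wx).
have : orbit_sum (\prod_(p <-
      [:: tperm w v, tperm w v, tperm w x, tperm w y & L]) p) =
    orbit_sum (\prod_(p <-
      [:: tperm w v, tperm w x, tperm w v, tperm w y & L]) p).
  by rewrite (tpermC w v); apply: (orbit_sum_invariant_eq inv); perm_words.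
rewrite !big_cons !tpermKg tperm_slide // -/p.
rewrite orbit_sum_star ?orbit_sum_disjoint //=; last first.
- by rewrite wx wy xy.
- by rewrite vx vw vy wy xy /= porbit_sym wx.
have := (card_porbit_gt0 p w, card_porbit_gt0 p v,
         card_porbit_gt0 p x, card_porbit_gt0 p y).
case=> [[[]]]; card_nia.
Qed.

(** The pair [v x, w y] can be traded for [w x, w y] or for [v x, v y]. The first trade makes the
    cycle of [v] longer than that of [w], the second makes it shorter. *)
Lemma even_bridge_absurd v w x y L :
    orbit_sum_invariant [:: tperm v w, tperm v w, tperm v x, tperm w y & L] ->
  ~~ separated (\prod_(p <- L) p) [:: v; w; x; y].
Proof.
move=> inv; apply/negP => sep; move: (sep) => /=; rewrite !andbT.
move=> /and3P[/and3P[vw vx vy] /andP[wx wy] xy].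
have [[wv xv] xw] := (separated_neq vw, separated_neq vx, separated_neq wx).
have [[yv yw] yx] := (separated_neq vy, separated_neq wy, separated_neq xy).
have : orbit_sum (\prod_(p <-
      [:: tperm v w, tperm v w, tperm v x, tperm w y & L]) p) =
    orbit_sum (\prod_(p <-
      [:: tperm v w, tperm v x, tperm v w, tperm w y & L]) p).
  by apply: (orbit_sum_invariant_eq inv); perm_words.
have : orbit_sum (\prod_(p <-
      [:: tperm v w, tperm v w, tperm v x, tperm w y & L]) p) =
    orbit_sum (\prod_(p <-
      [:: tperm v x, tperm w v, tperm w y, tperm w v & L]) p).
  by rewrite (tpermC w v); apply: (orbit_sum_invariant_eq inv); perm_words.
rewrite !big_cons !tpermKg (@tperm_slide _ v w x) // (@tperm_slide _ w v y) //.
set p := \prod_(i <- L) i in sep vw vx vy wx wy xy *.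
rewrite !orbit_sum_star ?orbit_sum_disjoint //=; last first.
all: rewrite ?wx ?wy ?xy ?vw ?vx ?vy ?[x \in porbit p w]porbit_sym ?wx //.
have := (card_porbit_gt0 p w, card_porbit_gt0 p v,
         card_porbit_gt0 p x, card_porbit_gt0 p y).
case=> [[[]]]; card_nia.
Qed.

End Words.

(** * Deleting a multiedge *)

Section Deletion.
Local Open Scope group_scope.
Variable T : finType.
Implicit Types (p q s t : {perm T}) (a b v w x y z : T) (L R X : seq {perm T}).

Definition del t L := [seq s <- L | s != t].

Lemma mem_del t L s : (s \in del t L) = (s != t) && (s \in L).
Proof. exact: mem_filter. Qed.

Lemma count_del t s L : s != t -> count_mem s (del t L) = count_mem s L.
Proof.
move=> st; rewrite count_filter; apply: eq_count => r /=.
by case: eqVneq => // ->.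
Qed.

(** Reduces a sequence to the short words above, one multiedge at a time: the copies of [t] are
    gathered and all but [j] cancel in pairs, while [X] keeps what was extracted before. *)
Lemma orbit_sum_invariant_extract X t j L : transposition t ->
  j <= count_mem t L -> odd j = odd (count_mem t L) ->
  orbit_sum_invariant (X ++ L) -> orbit_sum_invariant (X ++ nseq j t ++ del t L).
Proof.
move=> tt jk ojk inv.
have inv' : orbit_sum_invariant (nseq (count_mem t L) t ++ (X ++ del t L)).
  apply: orbit_sum_invariant_perm inv; rewrite perm_sym perm_catCA perm_cat2l.
  by rewrite perm_sym perm_nseq_count.
apply: (orbit_sum_invariant_perm _ (orbit_sum_invariant_nseq tt jk ojk inv')).
by rewrite perm_catCA.
Qed.

Lemma transposition_tperm x y : x != y -> transposition (tperm x y).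
Proof. by exists x, y. Qed.

Lemma edge_count L x y : edge L x y -> 0 < count_mem (tperm x y) L.
Proof. by case/andP=> _; rewrite -has_count has_pred1. Qed.

Lemma card_porbit_isolated L x : {in L, forall p, transposition p} ->
  (forall y, ~~ edge L x y) -> #|porbit (\prod_(p <- L) p) x| = 1%N.
Proof.
move=> tL isol; rewrite (_ : porbit _ _ = [set x]) ?cards1 //.
apply/setP=> y; rewrite inE; apply/idP/eqP => [/(porbit_connect tL)|->]; last first.
  exact: porbit_id.
by case/connectP=> [[|z s]] /= => [_ -> //|]; rewrite (negbTE (isol z)).
Qed.

Lemma connect_exit (e : rel T) (A : {set T}) x z : connect e x z ->
  x \in A -> z \notin A -> exists2 y, y \in A & exists2 w, w \notin A & e y w.
Proof.
case/connectP=> s; elim: s x => /= [|y s IHs] x; first by move=> _ -> ->.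
case/andP=> xy ys Ez Ax Az; have [Ay|nAy] := boolP (y \in A).
  exact: IHs ys Ez Ay Az.
by exists x => //; exists y.
Qed.

End Deletion.

(** * Necessity *)

Section Necessity.
Local Open Scope group_scope.
Variables (T : finType) (u : seq {perm T}).
Implicit Types (p q s t : {perm T}) (a b v w x y z : T) (L R : seq {perm T}).
Hypothesis tu : {in u, forall p, transposition p}.
Hypothesis connected_u : forall x y, connect (edge u) x y.
Hypothesis bridge_u :
  forall x y, edge u x y -> ~~ connect (edge (del (tperm x y) u)) x y.
Hypothesis cardT : 4 <= #|T|.
Hypothesis inv_u : orbit_sum_invariant u.

Let mu x y := count_mem (tperm x y) u.

Lemma edge_del v w x y : edge u x y -> tperm x y != tperm v w ->
  edge (del (tperm v w) u) x y.
Proof. by case/andP=> xy xyu ne; rewrite /edge xy mem_del ne. Qed.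

(** A common cycle would give a path from [y] to [x] in the graph of [R], hence one from [v] to [w]
    avoiding the bridge. *)
Lemma notin_porbit_bridge R v w x y : edge u v w ->
    {subset R <= u} -> tperm v w \notin R ->
    connect (edge (del (tperm v w) u)) v x ->
    connect (edge (del (tperm v w) u)) w y ->
  x \notin porbit (\prod_(p <- R) p) y.
Proof.
move=> vw Ru vwR vx wy; apply: contra (bridge_u vw).
have tR : {in R, forall p, transposition p} by move=> p /Ru/tu.
move/(porbit_connect tR) => yx; apply: connect_trans vx _.
rewrite edge_connect_sym; apply: connect_trans wy _.
apply: edge_sub yx => s Rs; rewrite mem_del Ru // andbT.
by apply: contraNneq vwR => <-.
Qed.

Lemma notin_porbit1 R v w : edge u v w -> {subset R <= u} ->
  tperm v w \notin R -> v \notin porbit (\prod_(p <- R) p) w.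
Proof. by move=> vw Ru vwR; apply: (notin_porbit_bridge vw). Qed.

Lemma notin_porbit2 R v w y : edge u v w -> edge u w y -> v != y ->
  {subset R <= u} -> tperm v w \notin R -> v \notin porbit (\prod_(p <- R) p) y.
Proof.
move=> vw wy vy Ru vwR; apply: (notin_porbit_bridge vw) => //.
by apply/connect1/edge_del; rewrite // (tpermC v) tperm_eq2 eq_sym.
Qed.

Lemma notin_porbit3 R v w x y : edge u v w -> edge u v x -> x != w ->
  edge u w y -> y != v -> {subset R <= u} -> tperm v w \notin R ->
  x \notin porbit (\prod_(p <- R) p) y.
Proof.
move=> vw vx xw wy yv Ru vwR; apply: (notin_porbit_bridge vw) => //.
  by apply/connect1/edge_del; rewrite // tperm_eq2.
by apply/connect1/edge_del; rewrite // (tpermC v) tperm_eq2.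
Qed.

Lemma separated_star R w a b : edge u w a -> edge u w b -> a != b ->
  {subset R <= u} -> tperm w a \notin R -> tperm w b \notin R ->
  separated (\prod_(p <- R) p) [:: w; a; b].
Proof.
move=> wa wb ab Ru waR wbR.
rewrite /= !andbT (notin_porbit1 wa) // (notin_porbit1 wb) //=.
by rewrite (@notin_porbit2 R a w b) // ?(edge_sym u a) // tpermC.
Qed.

Lemma sub_del t L : {subset L <= u} -> {subset del t L <= u}.
Proof. by move=> Lu s; rewrite mem_del => /andP[_ /Lu]. Qed.

Lemma edge_neq x y : edge u x y -> x != y.
Proof. by case/andP. Qed.

Lemma edge_tperm x y : edge u x y -> transposition (tperm x y).
Proof. by case/andP=> xy _; apply: transposition_tperm. Qed.

(** For equal parities, both multiplicities are lowered to two or both to three, and the alternating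
    arrangement gives the contradiction. *)
Lemma parity_star w a b : edge u w a -> edge u w b -> a != b ->
  1 < mu w a -> 1 < mu w b -> odd (mu w a) != odd (mu w b).
Proof.
move=> wa wb ab; rewrite /mu => mwa mwb; apply/negP=> /eqP odd_ab.
pose L := del (tperm w b) (del (tperm w a) u).
have ne : tperm w b != tperm w a by rewrite tperm_eq2 eq_sym.
have sep : separated (\prod_(p <- L) p) [:: w; a; b].
  apply: separated_star => //; first by do 2!apply: sub_del.
  - by rewrite !mem_del eqxx andbF.
  - by rewrite !mem_del eqxx.
case: (boolP (odd (mu w a))) => odd_a; rewrite /mu in odd_a; last first.
  have inv2 := @orbit_sum_invariant_extract T [::] (tperm w a) 2 u (edge_tperm wa) mwa.
  have {}inv2 := inv2 (esym (negbTE odd_a)) inv_u.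
  have := @orbit_sum_invariant_extract T (nseq 2 (tperm w a)) (tperm w b) 2
    (del (tperm w a) u) (edge_tperm wb) _ _ inv2.
  rewrite count_del // -odd_ab (negbTE odd_a) => /(_ mwb erefl).
  by move/even_even_absurd; rewrite sep.
have gt2 k : 1 < k -> odd k -> 2 < k by case: k => [|[|[]]].
have inv2 := @orbit_sum_invariant_extract T [::] (tperm w a) 3 u (edge_tperm wa).
have {}inv2 := inv2 (gt2 _ mwa odd_a) (esym odd_a) inv_u.
have := @orbit_sum_invariant_extract T (nseq 3 (tperm w a)) (tperm w b) 3
  (del (tperm w a) u) (edge_tperm wb) _ _ inv2.
rewrite count_del // -odd_ab odd_a gt2 -?odd_ab // => /(_ erefl erefl).
by move/odd_odd_absurd; rewrite sep.
Qed.

(** * Adjacent non-simple multiedges of opposite parity *)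

Section EvenOdd.
Variables w a b : T.
Hypotheses (wa : edge u w a) (wb : edge u w b) (ab : a != b).
Hypotheses (mwa : 1 < mu w a) (mwb : 1 < mu w b).
Hypotheses (even_a : ~~ odd (mu w a)) (odd_b : odd (mu w b)).

Let R := del (tperm w b) (del (tperm w a) u).

Lemma even_odd_invariant :
  orbit_sum_invariant [:: tperm w a, tperm w a,
                          tperm w b, tperm w b, tperm w b & R].
Proof.
have ne : tperm w b != tperm w a by rewrite tperm_eq2 eq_sym.
have inv2 := @orbit_sum_invariant_extract T [::] (tperm w a) 2 u (edge_tperm wa).
have {}inv2 := inv2 mwa (esym (negbTE even_a)) inv_u.
have := @orbit_sum_invariant_extract T (nseq 2 (tperm w a)) (tperm w b) 3
  (del (tperm w a) u) (edge_tperm wb) _ _ inv2.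
rewrite count_del // -/(mu w b) odd_b; apply=> //.
by case: (mu w b) mwb odd_b => [|[|[]]].
Qed.

Lemma even_odd_invariant_edge x y j :
    edge u x y -> tperm x y != tperm w a -> tperm x y != tperm w b ->
    j <= mu x y -> odd j = odd (mu x y) ->
  orbit_sum_invariant ([:: tperm w a; tperm w a; tperm w b; tperm w b; tperm w b]
    ++ nseq j (tperm x y) ++ del (tperm x y) R).
Proof.
move=> xy na nb jm oj; apply: orbit_sum_invariant_extract.
- exact: edge_tperm.
- by rewrite !count_del.
- by rewrite !count_del.
- exact: even_odd_invariant.
Qed.

Let waR : tperm w a \notin R. Proof. by rewrite !mem_del eqxx andbF. Qed.
Let wbR : tperm w b \notin R. Proof. by rewrite !mem_del eqxx. Qed.
Let sRu : {subset R <= u}. Proof. by do 2!apply: sub_del. Qed.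

(** A third multiedge at [w] would be simple, since [parity_star] against [w a] and [w b] excludes
    both parities. The three edges then contradict [even_odd_third_absurd]. *)
Lemma even_odd_neighbor x : edge u w x -> (x == a) || (x == b).
Proof.
move=> wx; apply: contraT; rewrite negb_or => /andP[xa xb].
have mwx : mu w x = 1%N.
  have := edge_count wx; rewrite -/(mu w x); case E: (mu w x) => [|[|k]] // _.
  have mwx : 1 < mu w x by rewrite E.
  have := parity_star wa wx; rewrite eq_sym => /(_ xa mwa mwx).
  have := parity_star wb wx; rewrite eq_sym => /(_ xb mwb mwx).
  by rewrite odd_b (negbTE even_a); case: (odd _).
have := @even_odd_invariant_edge w x 1 wx.
rewrite !tperm_eq2 mwx => /(_ xa xb isT erefl)/even_odd_third_absurd/negP[].
have sR' : {subset del (tperm w x) R <= u} by apply: sub_del.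
have aR : tperm w a \notin del (tperm w x) R by rewrite mem_del (negbTE waR) andbF.
have bR : tperm w b \notin del (tperm w x) R by rewrite mem_del (negbTE wbR) andbF.
have xR : tperm w x \notin del (tperm w x) R by rewrite mem_del eqxx.
have [aw bw] : edge u a w /\ edge u b w by rewrite !(edge_sym _ _ w).
rewrite /= !andbT (notin_porbit1 wa) // (notin_porbit1 wb) // (notin_porbit1 wx) //.
rewrite (notin_porbit2 aw wb) ?(tpermC a) //.
rewrite (notin_porbit2 aw wx) ?(tpermC a) 1?eq_sym //.
by rewrite (notin_porbit2 bw wx) ?(tpermC b) // eq_sym.
Qed.

Lemma even_odd_isolated L : {subset L <= u} -> tperm w a \notin L ->
  tperm w b \notin L -> #|porbit (\prod_(p <- L) p) w| = 1%N.
Proof.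
move=> Lu aL bL; apply: card_porbit_isolated => [p /Lu/tu //|y].
apply/negP=> /andP[wy wyL]; have := @even_odd_neighbor y.
rewrite /edge wy Lu // => /(_ isT) /orP[] /eqP Ey; move: wyL; rewrite Ey.
  by rewrite (negbTE aL).
by rewrite (negbTE bL).
Qed.

(** With [z x] odd, one copy can be kept in front of the remaining word. By [even_odd_card] the
    cycle of [z] is as short as that of [w], which is a fixed point, yet the kept copy puts [x] in
    it. *)
Lemma even_odd_end_even z x : z \in [set a; b] ->
  x \notin [set w; a; b] -> edge u z x -> ~~ odd (mu z x).
Proof.
move=> zab; rewrite !inE !negb_or => /andP[/andP[xw xa] xb] zx; apply/negP=> odd_zx.
have zw : z != w.
  by move: zab; rewrite !inE => /orP[] /eqP ->; rewrite eq_sym edge_neq.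
have neq v : v != x -> tperm z x != tperm w v.
  by move=> vx; rewrite tpermC tperm_neq // 1?eq_sym // edge_neq.
have na := neq a; have nb := neq b; rewrite 1?eq_sym xa in na; rewrite 1?eq_sym xb in nb.
have := @even_odd_invariant_edge z x 1 zx (na isT) (nb isT) (edge_count zx) (esym odd_zx).
set L := tperm z x :: del (tperm z x) R => inv.
have Lu : {subset L <= u}.
  by move=> s; rewrite inE => /orP[/eqP ->|/sub_del]; [case/andP: zx|apply].
have aL : tperm w a \notin L.
  by rewrite inE eq_sym (negbTE (na isT)) mem_del (negbTE waR) andbF.
have bL : tperm w b \notin L.
  by rewrite inE eq_sym (negbTE (nb isT)) mem_del (negbTE wbR) andbF.
have [] := even_odd_card inv (separated_star wa wb ab Lu aL bL).
rewrite even_odd_isolated // => ca cb.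
have : #|porbit (\prod_(p <- L) p) z| = 1%N.
  by move: zab; rewrite !inE => /orP[] /eqP ->.
move/eqP; rewrite eqn_leq => /andP[+ _]; rewrite leqNgt => /negP[].
apply/card_gt1P; exists z, x; split; rewrite ?edge_neq ?porbit_id //.
rewrite porbit_sym big_cons; apply: mem_porbit_tperm.
by apply: notin_porbit1; rewrite ?mem_del ?eqxx //; apply: sub_del.
Qed.

(** As there are at least four vertices, some edge leaves the three given ones. It does not start at
    [w], and it is even: at [a] this makes two even multiedges, at [b] it yields the path of
    [even_odd_even_absurd]. *)
Lemma even_odd_absurd : False.
Proof.
have [z] : exists z, z \notin [set w; a; b].
  have : [set w; a; b] \proper [set: T].
    rewrite properEcard subsetT cardsT (leq_trans _ cardT) // ltnS.
    by rewrite -setUA cardsU1 cards2; case: (_ \notin _); case: (a != b).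
  by case/properP=> _ [z _ nz]; exists z.
move=> nz; have [|v Av [x nAx vx]] := connect_exit (connected_u w z) _ nz.
  by rewrite !inE eqxx.
move: (nAx); rewrite !inE !negb_or => /andP[/andP[xw xa] xb].
have [vw|vnw] := eqVneq v w.
  by rewrite vw in vx; have := even_odd_neighbor vx; rewrite (negbTE xa) (negbTE xb).
have vab : v \in [set a; b] by move: Av; rewrite !inE (negbTE vnw).
have even_vx := even_odd_end_even vab nAx vx.
have gt1 : 1 < mu v x.
  by have := edge_count vx; move: even_vx; rewrite /mu; case: (count_mem _ _) => [|[]].
have aw : edge u a w by rewrite edge_sym.
move: vab; rewrite !inE => /orP[] /eqP Ev; rewrite {v}Ev in vx vnw even_vx gt1 Av.
  have := parity_star vx aw xw gt1; rewrite /mu (tpermC a w) => /(_ mwa).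
  by rewrite -/(mu w a) (negbTE even_a) (negbTE even_vx).
have na : tperm b x != tperm w a.
  by rewrite tpermC tperm_neq // 1?eq_sym // edge_neq // edge_sym.
have nb : tperm b x != tperm w b.
  by rewrite (tpermC w) tperm_eq2.
have := @even_odd_invariant_edge b x 2 vx na nb gt1 (esym (negbTE even_vx)).
move/even_odd_even_absurd/negP; apply; set L := del _ R.
have Lu : {subset L <= u} by apply: sub_del.
have aL : tperm w a \notin L by rewrite mem_del (negbTE waR) andbF.
have bL : tperm w b \notin L by rewrite mem_del (negbTE wbR) andbF.
have xL : tperm b x \notin L by rewrite mem_del eqxx.
rewrite /= !andbT.
rewrite (notin_porbit1 aw) ?(tpermC a) // (notin_porbit2 aw wb) ?(tpermC a) //.
rewrite (notin_porbit1 wb) // (notin_porbit1 vx) //.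
rewrite (notin_porbit2 wb vx) //= 1?eq_sym // ?andbT.
by rewrite (@notin_porbit3 L w b a x) // eq_sym.
Qed.

End EvenOdd.

Lemma nonsimple_star w a b : edge u w a -> edge u w b -> a != b ->
  1 < mu w a -> mu w b = 1%N.
Proof.
move=> wa wb ab mwa; have := edge_count wb; rewrite -/(mu w b).
case E: (mu w b) => [|[|k]] // _; have mwb : 1 < mu w b by rewrite E.
have := parity_star wa wb ab mwa mwb.
case: (boolP (odd (mu w a))) => oa; case: (boolP (odd (mu w b))) => ob // _.
  by case: (@even_odd_absurd w b a); rewrite // eq_sym.
by case: (@even_odd_absurd w a b).
Qed.

Lemma even_edge_gt1 v w : edge u v w -> ~~ odd (mu v w) -> 1 < mu v w.
Proof. by move/edge_count; rewrite /mu; case: (count_mem _ _) => [|[]]. Qed.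

(** By [nonsimple_star] the edges [v x] and [w y] are simple, so two copies of [v w] and one of each
    of these can be extracted for [even_bridge_absurd]. *)
Lemma even_edge_end v w x y : edge u v w -> ~~ odd (mu v w) ->
  edge u v x -> x != w -> edge u w y -> y != v -> False.
Proof.
move=> vw even_vw vx xw wy yv.
have gt1 := even_edge_gt1 vw even_vw.
have mvx : mu v x = 1%N by apply: (nonsimple_star vw) => //; rewrite eq_sym.
have wv : edge u w v by rewrite edge_sym.
have mwy : mu w y = 1%N.
  by apply: (nonsimple_star wv) => //; rewrite 1?eq_sym // /mu tpermC.
have nx : tperm v x != tperm v w by rewrite tperm_eq2.
have nyw : tperm w y != tperm v w by rewrite (tpermC v) tperm_eq2.
have ny : tperm w y != tperm v x.
  by rewrite tperm_neq ?(edge_neq wv) ?(edge_neq wy) // eq_sym.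
have i1 := @orbit_sum_invariant_extract T [::] (tperm v w) 2 u (edge_tperm vw) gt1
  (esym (negbTE even_vw)) inv_u.
have := @orbit_sum_invariant_extract T (nseq 2 (tperm v w)) (tperm v x) 1
  (del (tperm v w) u) (edge_tperm vx) _ _ i1.
rewrite count_del // -/(mu v x) mvx => /(_ erefl erefl).
move=> i2.
have := @orbit_sum_invariant_extract T (nseq 2 (tperm v w) ++ [:: tperm v x])
  (tperm w y) 1 (del (tperm v x) (del (tperm v w) u)) (edge_tperm wy) _ _ i2.
rewrite !count_del // -/(mu w y) mwy => /(_ erefl erefl) /even_bridge_absurd.
set L := del _ _; case/negP; have Lu : {subset L <= u} by do 3!apply: sub_del.
have vwL : tperm v w \notin L by rewrite !mem_del eqxx !andbF.
have vxL : tperm v x \notin L by rewrite !mem_del eqxx !andbF.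
have wyL : tperm w y \notin L by rewrite !mem_del eqxx.
rewrite /= !andbT (notin_porbit1 vw) // (notin_porbit1 vx) // (notin_porbit1 wy) //.
rewrite (notin_porbit2 vw wy) //= 1?eq_sym //.
by rewrite (notin_porbit2 wv vx) ?(notin_porbit3 vw vx) // 1?eq_sym // tpermC.
Qed.

(** If [x] and [y] differ, [even_center_card] gives [v] a cycle of length at least two, but the leaf
    [v] is fixed once the multiedge [v w] is gone. *)
Lemma even_twig_center v w x y : edge u v w -> ~~ odd (mu v w) ->
  (forall z, edge u v z -> z = w) ->
  edge u w x -> x != v -> edge u w y -> y != v -> x = y.
Proof.
move=> vw even_vw leaf_v wx xv wy yv; apply/eqP; apply: contraT => xy.
have gt1 := even_edge_gt1 vw even_vw.
have wv : edge u w v by rewrite edge_sym.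
have m1 z : edge u w z -> z != v -> mu w z = 1%N.
  by move=> wz zv; apply: (nonsimple_star wv) => //; rewrite 1?eq_sym // /mu tpermC.
have nz z : z != v -> tperm w z != tperm v w by rewrite (tpermC v) tperm_eq2.
have nxy : tperm w y != tperm w x by rewrite tperm_eq2 eq_sym.
have i1 := @orbit_sum_invariant_extract T [::] (tperm v w) 2 u (edge_tperm vw) gt1
  (esym (negbTE even_vw)) inv_u.
have := @orbit_sum_invariant_extract T (nseq 2 (tperm v w)) (tperm w x) 1
  (del (tperm v w) u) (edge_tperm wx) _ _ i1.
rewrite count_del ?nz // -/(mu w x) m1 // => /(_ erefl erefl).
move=> i2.
have := @orbit_sum_invariant_extract T (nseq 2 (tperm v w) ++ [:: tperm w x])
  (tperm w y) 1 (del (tperm w x) (del (tperm v w) u)) (edge_tperm wy) _ _ i2.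
rewrite !count_del ?nz // -/(mu w y) m1 // => /(_ erefl erefl).
set L := del (tperm w y) _ => inv; have Lu : {subset L <= u} by do 3!apply: sub_del.
have vwL : tperm v w \notin L by rewrite !mem_del eqxx !andbF.
have wxL : tperm w x \notin L by rewrite !mem_del eqxx !andbF.
have wyL : tperm w y \notin L by rewrite !mem_del eqxx.
have := even_center_card inv.
rewrite /= !andbT (notin_porbit1 vw) // (notin_porbit1 wx) // (notin_porbit1 wy) //.
rewrite (notin_porbit2 vw wx) 1?eq_sym // (notin_porbit2 vw wy) 1?eq_sym //.
rewrite (@notin_porbit2 L x w y) 1?(edge_sym _ x) 1?(tpermC x) //= => /(_ isT).
have -> : #|porbit (\prod_(p <- L) p) v| = 1%N.
  apply: card_porbit_isolated => [p /Lu/tu //|z]; apply/negP=> /andP[vz vzL].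
  have Ez : z = w by apply: leaf_v; rewrite /edge vz Lu.
  by rewrite Ez (negbTE vwL) in vzL.
by move/eqP; rewrite ltn_eqF // (leq_add (card_porbit_gt0 _ _) (card_porbit_gt0 _ _)).
Qed.

End Necessity.

(** * Cycles with a given support *)

Section CyclesOn.
Local Open Scope group_scope.
Variable T : finType.
Implicit Types (p q s t g : {perm T}) (a b v w x y z : T) (V : {set T}).

Lemma imset_setC (rT : finType) (f : T -> rT) V :
  f @: T = (f @: ~: V) :|: (f @: V).
Proof.
rewrite -imsetU setUC setUCr; apply/setP=> y.
by apply/imsetP/imsetP=> -[x _ ->]; exists x.
Qed.

(** When [V] is empty or a singleton, this is the identity. *)
Definition cycle_on V p :=
  (forall x, x \in V -> porbit p x = V) /\ (forall x, x \notin V -> p x = x).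

(** The conjugating permutation sends [(q ^+ i) a] to [(p ^+ i) a] for a base point [a] of [V], and
    fixes the points outside [V]. *)
Lemma cycle_on_conj V p q : cycle_on V p -> cycle_on V q -> exists g, p = q ^ g.
Proof.
move=> [pV pV'] [qV qV'].
have [V0|[a Va]] := set_0Vmem V.
  exists 1; rewrite conjg1; apply/permP=> x.
  by rewrite pV' ?qV' ?V0 ?inE.
have [cp cq] : #|porbit p a| = #|V| /\ #|porbit q a| = #|V| by rewrite pV ?qV.
have V0 : 0 < #|V| by rewrite -cp card_porbit_gt0.
pose tq := traject q a #|V|.
have utq : uniq tq by have := uniq_traject_porbit q a; rewrite cq.
have mtq x : (x \in tq) = (x \in V) by rewrite -(qV a Va) porbit_traject cq.
pose f x := if x \in V then (p ^+ index x tq) a else x.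
have fV x : (f x \in V) = (x \in V).
  by rewrite /f; case: ifP => // _; rewrite -(pV a Va) mem_porbit.
have fq i : f ((q ^+ i) a) = (p ^+ i) a.
  (* Both cycles have length [#|V|], so the exponent can be reduced below it, where [index] in the
     trajectory recovers it. *)
  have mod r : #|porbit r a| = #|V| -> (r ^+ i) a = (r ^+ (i %% #|V|)) a.
    move=> cr; rewrite [in LHS](divn_eq i #|V|) addnC expgD permM.
    rewrite mulnC expgM; set y := (r ^+ _) a.
    have ry : (r ^+ #|V|) y = y.
      have ra : (r ^+ #|V|) a = a by rewrite permX -cr iter_porbit.
      by rewrite /y -permM -expgD addnC expgD permM ra.
    by elim: (i %/ _) => [|k IHk]; rewrite ?perm1 // expgS permM ry.
  have ltV : i %% #|V| < #|V| by rewrite ltn_mod.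
  have Vq j : (q ^+ j) a \in V by rewrite -(qV a Va) mem_porbit.
  rewrite (mod _ cq) (mod _ cp) /f Vq.
  congr ((p ^+ _) _); rewrite permX -(nth_traject _ ltV) index_uniq //.
  by rewrite size_traject.
have f_inj : injective f.
  move=> x y fxy; have : (x \in V) = (y \in V) by rewrite -fV fxy fV.
  move: fxy; rewrite /f; case: ifP => Vx; case: ifP => Vy // fxy _.
  have utp : uniq (traject p a #|V|) by rewrite -cp uniq_traject_porbit.
  have lt z : z \in V -> index z tq < #|V|.
    by rewrite -mtq -index_mem size_traject.
  move: fxy; rewrite !permX -!(nth_traject _ (lt _ _)) //.
  move/eqP; rewrite nth_uniq ?size_traject ?lt // => /eqP exy.
  by rewrite -(nth_index a (s := tq) (x := x)) ?mtq // exy nth_index ?mtq.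
exists (perm f_inj); apply/permP=> y.
have [x ->] : exists x, y = perm f_inj x.
  by exists ((perm f_inj)^-1 y); rewrite permKV.
rewrite permJ !permE; case: (boolP (x \in V)) => Vx; last first.
  by rewrite /f qV' // (negbTE Vx) pV'.
have /porbitP[i ->] : x \in porbit q a by rewrite qV.
by rewrite -permM -expgSr !fq expgSr permM.
Qed.

Lemma card_porbits1 : #|porbits (1 : {perm T})| = #|T|.
Proof.
rewrite /porbits card_imset // => x y /eqP; rewrite eq_porbit_mem.
by case/porbitP=> i; rewrite expg1n perm1.
Qed.

Lemma porbit_fixed p x : p x = x -> porbit p x = [set x].
Proof.
move=> px; apply/setP=> y; rewrite inE; apply/idP/eqP => [|->]; last exact: porbit_id.
by case/porbitP=> i ->; elim: i => [|i IHi]; rewrite ?perm1 // expgSr permM IHi px.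
Qed.

Lemma card_porbits_fixed V p : (forall x, x \notin V -> p x = x) ->
  #|porbits p| = (#|~: V| + #|porbit p @: V|)%N.
Proof.
move=> fp; rewrite /porbits (imset_setC _ V).
have E : {in ~: V, porbit p =1 set1} by move=> x; rewrite inE => /fp/porbit_fixed.
rewrite (eq_in_imset E) cardsU [X in (_ - X)%N](_ : _ = 0) ?subn0.
  by rewrite (card_imset _ set1_inj).
apply/eqP; rewrite cards_eq0; apply/eqP/setP=> A; rewrite !inE.
apply/andP=> [] [/imsetP[x xV ->] /imsetP[y yV /setP/(_ y)]].
by rewrite porbit_id inE => /eqP Exy; rewrite -Exy inE yV in xV.
Qed.

(** The fixed points outside [V] already account for [#|~: V|] cycles, leaving at most one for
    [V]. *)
Lemma card_porbits_cycle_on V p : (forall x, x \notin V -> p x = x) ->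
  #|porbits p| <= #|~: V|.+1 -> cycle_on V p.
Proof.
move=> fp; rewrite (card_porbits_fixed fp) -addn1 leq_add2l => le1; split=> // x Vx.
apply/setP=> y; apply/idP/idP=> [|Vy].
  apply: contraTT => nVy; rewrite porbit_sym porbit_fixed ?fp // inE.
  by apply: contraNneq nVy => <-.
rewrite -eq_porbit_mem; apply/eqP.
by apply: (card_le1_eqP le1); apply: imset_f.
Qed.

End CyclesOn.

(** * Products over trees, and cancellation of even multiedges *)

Section Products.
Local Open Scope group_scope.
Variable T : finType.
Implicit Types (p q s t g : {perm T}) (a b v w x y z : T) (V : {set T}).
Implicit Types (L R : seq {perm T}).

(** Acyclicity in the form suited to induction on the sequence: each term joins two components of
    the graph of the later terms. In particular no transposition is repeated. *)
Definition forest L := forall L1 x y L2, L = L1 ++ tperm x y :: L2 ->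
  x != y -> ~~ connect (edge L2) x y.

(** Each new term on the left joins two cycles, because it joins two components. *)
Lemma card_porbits_forest L : {in L, forall p, transposition p} -> forest L ->
  (#|porbits (\prod_(p <- L) p)| + size L)%N = #|T|.
Proof.
elim: L => [|t L IHL] tL fL; first by rewrite big_nil card_porbits1 addn0.
have tL' : {in L, forall p, transposition p}.
  by move=> p Lp; apply: tL; rewrite inE Lp orbT.
have [x [y [xy tE]]] := tL t (mem_head _ _).
have nxy := fL [::] x y L; rewrite tE in nxy; have {}nxy := nxy erefl xy.
have := porbits_mul_tperm (\prod_(p <- L) p) x y.
have -> : x \notin porbit (\prod_(p <- L) p) y.
  by rewrite porbit_sym; apply: contra nxy => /(porbit_connect tL').
rewrite xy /= addn1 addn2 => -[Eporb]; rewrite big_cons tE addnS -addSn Eporb.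
by apply: IHL => // L1 z w L2 LE; apply: (fL (t :: L1)); rewrite LE.
Qed.

(** The labels stand for components: a graph with [k] edges has at least [#|T| - k] of them. *)
Lemma edge_labelling L : exists2 f : T -> T,
  (forall x y, edge L x y -> f x = f y) & #|T| <= #|f @: T| + size L.
Proof.
elim: L => [|t L [f fL cf]].
  exists id => [x y|]; first by rewrite /edge in_nil andbF.
  by rewrite card_imset // addn0.
have [/existsP[x /existsP[y /eqP tE]]|] :=
  boolP [exists x, exists y, t == tperm x y]; last first.
  move=> nt; exists f => [x y /andP[xy]|]; last by rewrite /= addnS (leq_trans cf).
  rewrite inE => /orP[/eqP tE|xyL]; last by apply: fL; rewrite /edge xy.
  by case/existsP: nt; exists x; apply/existsP; exists y; rewrite tE.
(* The new edge merges the label of [x] into that of [y], losing at most one label. *)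
pose h z := if z == f x then f y else z.
exists (h \o f) => [z w /andP[zw]|]; last first.
  apply: leq_trans cf _; rewrite /= addnS -addSn leq_add2r.
  have sub : f @: T \subset f x |: ((h \o f) @: T).
    apply/subsetP=> _ /imsetP[z _ ->]; rewrite !inE.
    case: eqVneq => //= nfx; apply/imsetP; exists z => //=.
    by rewrite /h (negbTE nfx).
  apply: leq_trans (subset_leq_card sub) _; rewrite cardsU1.
  by case: (_ \notin _); rewrite ?add0n ?leqnSn.
rewrite inE => /orP[/eqP|zwL] /=; last by rewrite (fL z w) // /edge zw.
rewrite tE => E; have : tperm x y z = w by rewrite -E tpermL.
rewrite /h; case: tpermP => [->|->|_ _] Ew; rewrite -?Ew.
- by rewrite eqxx; case: ifP => // /eqP ->.
- by rewrite eqxx; case: ifP => // /eqP ->.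
by rewrite Ew eqxx in zw.
Qed.

(** The labelling takes at most one value on [V] and at most [#|~: V|] values elsewhere. *)
Lemma connected_size V L : {in V &, forall x y, connect (edge L) x y} ->
  #|V| <= (size L).+1.
Proof.
move=> cV; have [f fL cf] := edge_labelling L.
have fc x y : connect (edge L) x y -> f x = f y.
  case/connectP=> s; elim: s x => /= [|z s IHs] x; first by move=> _ ->.
  by case/andP=> /fL -> zs Ey; apply: IHs Ey.
have V1 : #|f @: V| <= 1.
  by apply/card_le1_eqP=> _ _ /imsetP[x Vx ->] /imsetP[y Vy ->]; apply: fc; apply: cV.
have : #|f @: T| <= #|f @: V| + #|~: V|.
  rewrite (imset_setC f V) (leq_trans (leq_card_setU _ _)) // addnC leq_add2l.
  exact: leq_imset_card.
have := cardsC V; lia.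
Qed.

Lemma prod_fixed V L : {in L, forall t, forall x, x \notin V -> t x = x} ->
  forall x, x \notin V -> (\prod_(p <- L) p) x = x.
Proof.
elim: L => [|t L IHL] fL x nVx; first by rewrite big_nil perm1.
rewrite big_cons permM (fL t) ?mem_head // IHL // => s Ls.
by apply: fL; rewrite inE Ls orbT.
Qed.

(** The terms form a forest, since an edge closing a circuit could be dropped, leaving too few to
    connect [V]. Counting cycles then leaves a single one on [V]. *)
Lemma tree_cycle_on V L : {in L, forall p, transposition p} ->
    {in L, forall t, forall x, x \notin V -> t x = x} ->
    {in V &, forall x y, connect (edge L) x y} -> size L < #|V| ->
  cycle_on V (\prod_(p <- L) p).
Proof.
move=> tL fL cL sL; have fp := prod_fixed fL.
apply: card_porbits_cycle_on => //.
suff /card_porbits_forest : forest L.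
  by move=> /(_ tL); have := cardsC V; have := connected_size cL; lia.
move=> L1 x y L2 LE xy; apply/negP=> xyL2.
have : #|V| <= (size (L1 ++ L2)).+1.
  apply: connected_size => z w Vz Vw; apply: connect_sub (cL z w Vz Vw) => a b.
  rewrite /edge LE mem_cat inE => /andP[ab abL].
  have sub2 : {subset L2 <= L1 ++ L2} by move=> r Lr; rewrite mem_cat Lr orbT.
  have [abE|nab] := eqVneq (tperm a b) (tperm x y); last first.
    by apply: connect1; rewrite /edge ab mem_cat; move: abL; rewrite (negbTE nab).
  have xyL := edge_sub sub2 xyL2; have : tperm x y a = b by rewrite -abE tpermL.
  case: tpermP => [->|->|_ _] E; rewrite -?E //.
  by rewrite edge_connect_sym.
by move: sL; rewrite LE !size_cat /=; lia.
Qed.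

Lemma prod_catC L R :
  \prod_(p <- L ++ R) p = (\prod_(p <- R ++ L) p) ^ (\prod_(p <- R) p).
Proof. by rewrite !big_cat /= /conjg !mulgA mulVg mul1g. Qed.

Lemma prod_rotate t L : t \in L -> exists2 R,
  perm_eq L (t :: R) & exists g, \prod_(p <- L) p = (t * \prod_(p <- R) p) ^ g.
Proof.
case/splitPr=> L1 L2; exists (L2 ++ L1); first by rewrite perm_catC.
by exists (\prod_(p <- t :: L2) p); rewrite prod_catC /= big_cons.
Qed.

Lemma prod_commute e L : {in L, forall t, commute t e} ->
  \prod_(p <- L) p = e ^+ count_mem e L * \prod_(p <- del e L) p.
Proof.
elim: L => [|t L IHL] cL; first by rewrite !big_nil mulg1.
have {}IHL : \prod_(p <- L) p = e ^+ count_mem e L * \prod_(p <- del e L) p.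
  by apply: IHL => s Ls; apply: cL; rewrite inE Ls orbT.
rewrite big_cons IHL /=; case: eqVneq => [->|nte] /=; first by rewrite expgS mulgA.
rewrite big_cons add0n !mulgA; congr (_ * _).
by apply: commuteX; apply: cL; rewrite mem_head.
Qed.

(** A rotation puts [c], the only term that may fail to commute with [e], in front. The copies of
    [e] then gather into an even power of an involution. *)
Lemma cancel_even_edge e c L : e * e = 1 -> ~~ odd (count_mem e L) ->
    c != e -> count_mem c L = 1%N -> {in L, forall t, t != c -> commute t e} ->
  exists2 R, perm_eq R (del e L)
    & exists g, \prod_(p <- L) p = (\prod_(p <- R) p) ^ g.
Proof.
move=> ee even_e ce c1 comm.
have cL : c \in L by rewrite -has_pred1 has_count c1.
have [R LR [g E]] := prod_rotate cL.
have cR : count_mem c R = 0%N.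
  by move: c1; rewrite (seq.permP LR) /= eqxx; lia.
have commR : {in R, forall t, commute t e}.
  move=> t Rt; apply: comm; first by rewrite (perm_mem LR) inE Rt orbT.
  by apply: contraTneq Rt => ->; rewrite -has_pred1 has_count cR.
have evR : e ^+ count_mem e R = 1.
  move: even_e; rewrite (seq.permP LR) /= (negbTE ce) add0n => evR.
  by rewrite -(even_halfK evR) -muln2 mulnC expgM expgS expg1 ee expg1n.
exists (c :: del e R).
  by have := perm_filter (fun s => s != e) LR; rewrite /= ce perm_sym.
by exists g; rewrite E (prod_commute commR) evR mul1g big_cons.
Qed.

(** Requiring [c] outside [s] keeps each partner in the sequence while other members of [s] are
    cancelled. *)
Lemma cancel_even_edges (s : seq {perm T}) L :
    {in s, forall e, [/\ e * e = 1, ~~ odd (count_mem e L) &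
      exists c, [/\ c \notin s, count_mem c L = 1%N
                  & {in L, forall t, t != c -> commute t e}]]} ->
  exists2 R, perm_eq R [seq t <- L | t \notin s]
    & exists g, \prod_(p <- L) p = (\prod_(p <- R) p) ^ g.
Proof.
elim: s L => [|e s IHs] L hs.
  by exists L; [rewrite filter_predT|exists 1; rewrite conjg1].
have [ee even_e [c [cs c1 comm]]] := hs e (mem_head _ _).
have ce : c != e by move: cs; rewrite inE negb_or => /andP[].
have [R RL [g E]] := cancel_even_edge ee even_e ce c1 comm.
have [e' se'|R' RR' [g' E']] := IHs R.
  have [e2 even_e' [c' [cs' c1' comm']]] := hs e' ltac:(by rewrite inE se' orbT).
  move: cs'; rewrite inE negb_or => /andP[c'e c's].
  split=> //.
    rewrite (seq.permP RL); have [->|ne] := eqVneq e' e; last by rewrite count_del.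
    by rewrite (count_memPn _) // mem_del eqxx.
  exists c'; split=> // [|t]; first by rewrite (seq.permP RL) count_del.
  by rewrite (perm_mem RL) mem_del => /andP[_ /comm'].
exists R'; last by exists (g' * g); rewrite E E' conjgM.
apply: (perm_trans RR'); have := perm_filter (fun t => t \notin s) RL.
rewrite -filter_predI => /perm_trans; apply; apply/seq.permP => P.
rewrite !count_filter; apply: eq_count => t /=.
by rewrite inE negb_or; case: (t == e); rewrite ?andbT ?andbF.
Qed.

End Products.

(** * Odd multiplicities *)

Section Relocation.
Local Open Scope group_scope.
Variable T : finType.
Implicit Types (p q s t g m : {perm T}) (a b v w x y z : T) (V : {set T}).
Implicit Types (L R : seq {perm T}) (M : {set {perm T}}).

Lemma prod_conj m L : \prod_(p <- [seq t ^ m | t <- L]) p = (\prod_(p <- L) p) ^ m.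
Proof.
elim: L => [|t L IHL]; first by rewrite !big_nil conj1g.
by rewrite /= !big_cons IHL conjMg.
Qed.

Lemma relocate_prod m C D : m * m = 1 ->
  \prod_(p <- m :: C ++ m :: D) p = \prod_(p <- [seq t ^ m | t <- C] ++ D) p.
Proof.
move=> mm; have mV : m^-1 = m by apply/eqP; rewrite eq_invg_mul mm.
by rewrite big_cons !big_cat /= big_cons prod_conj /conjg mV !mulgA.
Qed.

Lemma transposition_conj t g : transposition t -> transposition (t ^ g).
Proof.
case=> x [y [xy ->]]; exists (g x), (g y); rewrite tpermJ; split=> //.
by rewrite (inj_eq perm_inj).
Qed.

(** A further copy of [m] survives, so every point stays connected to its image under [m]; an edge
    of [C] is recovered from its conjugate by such steps at both ends. *)
Lemma relocate_connect m C D x y : transposition m -> m \in C ++ D ->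
  edge (m :: C ++ m :: D) x y -> connect (edge ([seq t ^ m | t <- C] ++ D)) x y.
Proof.
move=> tm mCD; set L := _ ++ D.
have mL : m \in L.
  move: mCD; rewrite !mem_cat => /orP[mC|->]; last by rewrite orbT.
  by apply/orP; left; apply/mapP; exists m => //; rewrite conjgE mulKg.
have cm z : connect (edge L) z (m z).
  case: tm mL => a [b [ab ->]] abL.
  have ab1 : edge L a b by rewrite /edge ab.
  by case: tpermP => [->|->|//]; apply: connect1; rewrite // edge_sym.
case/andP=> xy; rewrite inE mem_cat inE => /or4P[/eqP E|xyC|/eqP E|xyD].
all: try by apply: connect1; rewrite /edge xy E.
  apply: (connect_trans (cm x)); rewrite edge_connect_sym.
  apply: (connect_trans (cm y)); rewrite edge_connect_sym.
  apply: connect1; rewrite /edge (inj_eq perm_inj) xy -tpermJ mem_cat.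
  by rewrite (map_f (fun t => t ^ m)).
by apply: connect1; rewrite /edge xy mem_cat xyD orbT.
Qed.

Lemma conjg_commute m t : commute t m -> t ^ m = t.
Proof. by move=> c; rewrite conjgE c mulKg. Qed.

(** Induction on the length: two copies of some [m] in [M] are removed by relocation. Elements of
    [M] commute with [m], so conjugation preserves their parities, and the bound counts each of them
    once however often it occurs. *)
Lemma odd_tree_cycle_on M V L : {in M, forall m, transposition m} ->
    {in M &, forall m m', commute m m'} ->
    {in L, forall p, transposition p} ->
    {in L, forall t, forall x, x \notin V -> t x = x} ->
    {in V &, forall x y, connect (edge L) x y} ->
    {in M, forall m, odd (count_mem m L)} ->
    count (fun t => t \notin M) L + #|M| < #|V| ->
  exists2 p, cycle_on V p & exists g, \prod_(p <- L) p = p ^ g.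
Proof.
move=> tM cM; have [k] := ubnP (size L); elim: k L => // k IHk L ltk tL fL cL oL sL.
have [/existsP[m /andP[Mm m1]]|none] :=
  boolP [exists m, (m \in M) && (1 < count_mem m L)].
  have mL : m \in L by rewrite -has_pred1 has_count (ltnW m1).
  have [R LR [g E]] := prod_rotate mL.
  have mR : m \in R.
    by move: m1; rewrite (seq.permP LR) /= eqxx ltnS -has_count has_pred1.
  case/splitPr: mR => C D in LR E.
  have mm := tperm_square (tM m Mm).
  have ME t : (t ^ m \in M) = (t \in M).
    apply/idP/idP=> Mt; last by rewrite conjg_commute //; apply: cM.
    by rewrite -(conjgK m t) conjg_commute // /commute; apply/commuteV; apply: cM.
  pose L' := [seq t ^ m | t <- C] ++ D.
  have cnt (P : pred {perm T}) : (forall t, P (t ^ m) = P t) ->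
      count P L = (P m + P m + count P L')%N.
    move=> PJ; rewrite (seq.permP LR) /= !count_cat /= count_map (eq_count PJ).
    by rewrite -!addnA [X in _ = (_ + X)%N]addnCA.
  have LE : \prod_(p <- L) p = (\prod_(p <- L') p) ^ g.
    by rewrite E -relocate_prod // big_cons.
  have memL t : t \in C ++ D -> t \in L.
    by rewrite (perm_mem LR) !(inE, mem_cat) => /orP[] ->; rewrite ?orbT.
  (* An odd multiplicity above one leaves a third copy. *)
  have mCD : m \in C ++ D.
    apply: contraT; rewrite mem_cat negb_or => /andP[nC nD]; have := oL m Mm.
    by rewrite (seq.permP LR) /= count_cat /= eqxx !(count_memPn _).
  have [||t|x y Vx Vy|m' Mm'||p cp [g' E']] := IHk L'.
  - by move: ltk; rewrite (perm_size LR) /= !size_cat size_map /= addnS ltnS => /ltnW.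
  - move=> t; rewrite mem_cat => /orP[/mapP[r Cr ->]|Dt].
      by apply/transposition_conj/tL/memL; rewrite mem_cat Cr.
    by apply/tL/memL; rewrite mem_cat Dt orbT.
  - rewrite mem_cat => /orP[/mapP[r Cr ->]|Dt] x nVx; last first.
      by apply: fL => //; apply: memL; rewrite mem_cat Dt orbT.
    have mx : m x = x by apply: fL.
    by rewrite -{1}mx permJ (fL r) // memL // mem_cat Cr.
  - apply: connect_sub (cL x y Vx Vy) => z w zw; apply: relocate_connect => //.
      exact: tM.
    by move: zw; rewrite /edge (perm_mem LR).
  - have := oL m' Mm'; rewrite (cnt (pred1 m')) /= ?addnn ?oddD ?odd_double //.
    move=> t /=; apply/eqP/eqP=> [E1|->]; last by apply/conjg_commute/cM.
    by rewrite -(conjgK m t) E1; apply/conjg_commute/commuteV/cM.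
  - move: sL; rewrite (cnt (fun t => t \notin M)) ?Mm // => t.
    by rewrite ME.
  - by exists p => //; exists (g' * g); rewrite LE E' conjgM.
(* Now each element of [M] occurs exactly once, so the bound becomes [size L < #|V|]. *)
exists (\prod_(p <- L) p); last by exists 1; rewrite conjg1.
apply: tree_cycle_on => //; apply: leq_ltn_trans sL.
rewrite -(count_predC [in M] L) addnC leq_add2l -size_filter.
set F := filter _ _.
have uF : uniq F.
  apply: count_mem_uniq => t; rewrite mem_filter.
  case: (boolP (t \in M)) => /= Mt; last first.
    by rewrite (count_memPn _) // mem_filter (negbTE Mt).
  have := oL t Mt; have := none; rewrite negb_exists => /forallP/(_ t).
  have -> : count_mem t F = count_mem t L.
    by rewrite count_filter; apply: eq_count => r /=; case: eqVneq => //= ->.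
  by rewrite Mt /= -leqNgt -has_pred1 has_count; case: (count_mem t L) => [|[]].
rewrite -(card_uniqP uF) subset_leq_card //; apply/subsetP=> t.
by rewrite mem_filter => /andP[].
Qed.

End Relocation.

(** * Sufficiency *)

Section Sufficiency.
Local Open Scope group_scope.
Variables (T : finType) (u : seq {perm T}).
Implicit Types (p q s t : {perm T}) (a b v w x y z : T) (L R : seq {perm T}).
Hypothesis tu : {in u, forall p, transposition p}.
Hypothesis connected_u : forall x y, connect (edge u) x y.
Hypothesis bridge_u :
  forall x y, edge u x y -> ~~ connect (edge (del (tperm x y) u)) x y.
Variable x0 : T.

Let mu x y := count_mem (tperm x y) u.

(** Condition (2) in terms of elements: [v] is the leaf, and [v] and [x] are the two neighbors of
    [w]. *)
Definition thin_twig v w := [/\ edge u v w, forall z, edge u v z -> z = w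
  & exists x, [/\ x != v, edge u w x & forall z, edge u w z -> z = v \/ z = x]].

Hypothesis nonsimple_u : forall w a b, edge u w a -> edge u w b ->
  1 < mu w a -> 1 < mu w b -> a = b.
Hypothesis even_u : forall v w, edge u v w -> ~~ odd (mu v w) ->
  thin_twig v w \/ thin_twig w v.

Definition even_leaf v :=
  [exists w, [&& edge u v w, ~~ odd (mu v w) & [forall z, edge u v z ==> (z == w)]]].

(** The vertices that survive the cancellation of the even multiedges. *)
Let V := [set v | ~~ even_leaf v].
Let M := [set t | (1 < count_mem t u) && odd (count_mem t u)].
Let O := [seq t <- u | odd (count_mem t u)].

Lemma mu_sym x y : mu x y = mu y x.
Proof. by rewrite /mu tpermC. Qed.

Lemma tperm_edge t : t \in u -> exists x y, edge u x y /\ t = tperm x y.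
Proof.
by move=> ut; have [x [y [xy tE]]] := tu ut; exists x, y; rewrite /edge xy -tE.
Qed.

Lemma tperm_commute x y z w : x != z -> x != w -> y != z -> y != w ->
  commute (tperm x y) (tperm z w).
Proof.
move=> xz xw yz yw; apply/commgP/conjg_fixP.
by rewrite tpermJ !tpermD // eq_sym.
Qed.

Lemma edge_odd x y : edge u x y -> odd (mu x y) -> edge O x y.
Proof. by case/andP=> xy xyu odd_xy; rewrite /edge xy mem_filter odd_xy. Qed.

Lemma odd_edge_V x y : edge u x y -> odd (mu x y) -> x \in V.
Proof.
move=> xy odd_xy; rewrite inE; apply/existsPn=> w.
apply/negP=> /and3P[_ ev /forallP/(_ y)].
by rewrite xy /= => /eqP yw; rewrite -yw odd_xy in ev.
Qed.

Lemma twig_center v w : thin_twig v w -> w \in V.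
Proof.
move=> [vw _ [x [xv wx _]]]; rewrite inE; apply/existsPn=> y.
apply/negP=> /and3P[_ _ /forallP leaf_w].
have := leaf_w v; rewrite edge_sym vw /= => /eqP vy.
by have := leaf_w x; rewrite wx /= -vy (negbTE xv).
Qed.

Lemma twig_leaf v w : thin_twig v w -> ~~ odd (mu v w) -> v \notin V.
Proof.
move=> [vw leaf_v _] ev; rewrite inE negbK; apply/existsP; exists w.
by rewrite vw ev /=; apply/forallP=> z; apply/implyP=> /leaf_v ->.
Qed.

Lemma inhabited_V : exists a, a \in V.
Proof.
case: (boolP (x0 \in V)) => [|]; first by exists x0.
rewrite inE negbK => /existsP[w /and3P[vw ev _]].
by case: (even_u vw ev) => /twig_center; [exists w|exists x0].
Qed.

(* The retraction sending each leaf of an even multitwig to its neighbor. *)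
Let rho v := if v \in V then v else odflt v [pick w | edge u v w].

(** An odd edge has both ends in [V] and is kept; [rho] collapses an even one to its non-leaf
    vertex. *)
Lemma rho_connect x y : edge u x y -> connect (edge O) (rho x) (rho y).
Proof.
have rhoV z : z \in V -> rho z = z by rewrite /rho => ->.
have rhoL v w : thin_twig v w -> ~~ odd (mu v w) -> rho v = w.
  move=> tw ev; rewrite /rho (negbTE (twig_leaf tw ev)).
  case: tw => vw leaf_v _; case: pickP => [z /leaf_v //|/(_ w)].
  by rewrite vw.
move=> xy; case: (boolP (odd (mu x y))) => [oxy|exy].
  have yx : edge u y x by rewrite edge_sym.
  rewrite !rhoV ?(odd_edge_V xy) ?(odd_edge_V yx) // 1?mu_sym //.
  by apply/connect1/edge_odd.
have eyx : ~~ odd (mu y x) by rewrite mu_sym.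
by case: (even_u xy exy) => tw; rewrite (rhoL _ _ tw) // rhoV // (twig_center tw).
Qed.

Lemma connected_V : {in V &, forall x y, connect (edge O) x y}.
Proof.
move=> x y Vx Vy; have := connected_u x y.
have [Ex Ey] : rho x = x /\ rho y = y by rewrite /rho Vx Vy.
rewrite -{2}Ex -{2}Ey; case/connectP=> s xs ->; elim: s x xs {Vx Ex} => //= z s IHs x.
by case/andP=> /rho_connect xz /IHs; apply: connect_trans.
Qed.

(** By condition (1), two distinct non-simple multiedges share no vertex. *)
Lemma nonsimple_commute : {in M &, forall m m', commute m m'}.
Proof.
move=> m m'; rewrite !inE => /andP[m1 _] /andP[m1' _].
have mem t : 1 < count_mem t u -> t \in u.
  by move=> t1; rewrite -has_pred1 has_count ltnW.
have [x [y [xy mE]]] := tperm_edge (mem _ m1).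
have [z [w [zw m'E]]] := tperm_edge (mem _ m1').
have shared a b c : edge u a b -> edge u a c ->
    1 < mu a b -> 1 < mu a c -> commute (tperm a b) (tperm a c).
  by move=> ab ac b1 c1; rewrite (nonsimple_u ab ac b1 c1).
rewrite mE in m1 *; rewrite m'E in m1' *.
have yx : edge u y x by rewrite edge_sym.
have wz : edge u w z by rewrite edge_sym.
have m2 : 1 < mu y x by rewrite mu_sym.
have m2' : 1 < mu w z by rewrite mu_sym.
have [xz|xz] := eqVneq x z; first by rewrite xz in xy m1 *; apply: shared.
have [xw|xw] := eqVneq x w.
  by rewrite xw in xy m1 *; rewrite (tpermC z); apply: shared.
have [yz|yz] := eqVneq y z.
  by rewrite yz in yx m2 *; rewrite (tpermC x); apply: shared.
have [yw|yw] := eqVneq y w.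
  by rewrite yw in yx m2 *; rewrite (tpermC x) (tpermC z); apply: shared.
exact: tperm_commute.
Qed.

Lemma odd_fixed : {in O, forall t, forall x, x \notin V -> t x = x}.
Proof.
move=> t; rewrite mem_filter => /andP[ot /tperm_edge[a [b [ab tE]]]] x nVx.
have ba : edge u b a by rewrite edge_sym.
have Va : a \in V by apply: (odd_edge_V ab); rewrite /mu -tE.
have Vb : b \in V by apply: (odd_edge_V ba); rewrite mu_sym /mu -tE.
by rewrite tE tpermD //; [apply: contraNneq nVx => <-|apply: contraNneq nVx => <-].
Qed.

Lemma transposition_odd : {in O, forall t, transposition t}.
Proof. by move=> t; rewrite mem_filter => /andP[_ /tu]. Qed.

Lemma count_odd m : odd (count_mem m u) -> count_mem m O = count_mem m u.
Proof.
move=> om; rewrite count_filter; apply: eq_count => t /=.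
by case: eqVneq => //= ->.
Qed.

Lemma nonsimple_odd : {subset M <= O}.
Proof.
move=> t; rewrite inE => /andP[t1 ot].
by rewrite mem_filter ot -has_pred1 has_count ltnW.
Qed.

Lemma size_odd : count (fun t => t \notin M) O + #|M| < #|V|.
Proof.
(* Each odd multiedge is listed exactly once; a term of [O] outside [M] is simple. *)
pose K := [seq t <- O | t \notin M] ++ enum M.
have KO : {subset K <= O}.
  by move=> t; rewrite mem_cat mem_filter mem_enum => /orP[/andP[]|/nonsimple_odd].
have uK : uniq K.
  rewrite cat_uniq enum_uniq andbT; apply/andP; split; last first.
    by apply/hasPn=> t; rewrite mem_enum mem_filter => ->.
  apply: count_mem_uniq => t; rewrite mem_filter.
  case: (boolP (t \in M)) => /= Mt; first by rewrite (count_memPn _) // mem_filter Mt.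
  case: (boolP (t \in O)) => Ot; last first.
    by rewrite (count_memPn _) // mem_filter (negbTE Ot) andbF.
  have -> : count_mem t [seq r <- O | r \notin M] = count_mem t O.
    by rewrite count_filter; apply: eq_count => r /=; case: eqVneq => //= ->.
  move: (Ot) Mt; rewrite mem_filter => /andP[ot _].
  rewrite inE ot andbT count_odd //.
  by case: (count_mem t u) ot => [|[]].
(* The later terms avoid the edge [x y], since [K] has no repetition, and this edge is a bridge. *)
have fK : forest K.
  move=> K1 x y K2 KE xy.
  have xyu : edge u x y.
    have : tperm x y \in O by apply: KO; rewrite KE mem_cat mem_head orbT.
    rewrite /edge xy.
    by rewrite mem_filter => /andP[].
  apply: contra (bridge_u xyu); apply: edge_sub => t K2t.
  rewrite mem_del; apply/andP; split.
    apply: contraTneq K2t => ->; move: uK; rewrite KE cat_uniq /=.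
    by case/and3P=> _ _ /andP[].
  have : t \in O by apply: KO; rewrite KE mem_cat inE K2t !orbT.
  by rewrite mem_filter => /andP[].
have tK : {in K, forall t, transposition t} by move=> t /KO/transposition_odd.
have fixK : {in K, forall t, forall x, x \notin V -> t x = x}.
  by move=> t /KO/odd_fixed.
have := card_porbits_forest tK fK.
rewrite (card_porbits_fixed (prod_fixed fixK)) -(cardsC V).
have [a Va] := inhabited_V.
(* The cycles number [#|~: V|] outside [V] and at least one on [V], which bounds the size of [K]
   strictly by [#|V|]. *)
have D1 : 0 < #|porbit (\prod_(p <- K) p) @: V|.
  by apply/card_gt0P; exists (porbit (\prod_(p <- K) p) a); apply: imset_f.
rewrite size_cat -cardE size_filter -addnA addnC => /eqP; rewrite eqn_add2r => /eqP <-.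
by rewrite -[X in X < _]add0n ltn_add2r.
Qed.

(** The partner is the other multiedge at the non-leaf vertex: it is simple by condition (1), and no
    other multiedge meets [t]. *)
Lemma even_edge_partner t : t \in u -> ~~ odd (count_mem t u) ->
  exists c, count_mem c u = 1%N /\ {in u, forall s, s != c -> commute s t}.
Proof.
move=> ut et.
have [v [w [tw tE]]] : exists v w, thin_twig v w /\ t = tperm v w.
  have [x [y [xy tE]]] := tperm_edge ut; rewrite tE in et.
  by case: (even_u xy et) => tw; [exists x, y|exists y, x; rewrite tpermC].
case: tw => vw leaf_v [x [xv wx nb_w]].
have wv : edge u w v by rewrite edge_sym.
exists (tperm w x); split.
  have := edge_count wx; case E: (count_mem _ _) => [|[|k]] // _.
  have wv1 : 1 < mu w v.
    rewrite mu_sym; have := edge_count vw; move: et; rewrite tE /mu.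
    by case: (count_mem _ _) => [|[]].
  have wx1 : 1 < mu w x by rewrite /mu E.
  by rewrite (nonsimple_u wv wx wv1 wx1) eqxx in xv.
have at_v z : edge u v z -> commute (tperm v z) (tperm v w) by move/leaf_v=> ->.
have at_w z : edge u w z -> tperm w z != tperm w x -> commute (tperm w z) (tperm v w).
  by case/nb_w=> ->; rewrite ?eqxx // tpermC.
move=> s us; have [y [z [yz sE]]] := tperm_edge us; rewrite {s us}sE tE => nc.
have zy : edge u z y by rewrite edge_sym.
have [yv|yv] := eqVneq y v; first by rewrite yv in yz *; apply: at_v.
have [zv|zv] := eqVneq z v; first by rewrite zv in zy *; rewrite tpermC; apply: at_v.
have [yw|yw] := eqVneq y w; first by rewrite yw in yz nc *; apply: at_w.
have [zw|zw] := eqVneq z w; last exact: tperm_commute.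
by rewrite zw in zy nc *; rewrite tpermC in nc *; apply: at_w.
Qed.

Lemma rearrangement_cycle_on r : perm_eq r u ->
  exists2 p, cycle_on V p & exists g, \prod_(p <- r) p = p ^ g.
Proof.
move=> ru; pose s := [seq t <- u | ~~ odd (count_mem t u)].
have [t st|R RO [g E]] := @cancel_even_edges _ s r.
  move: st; rewrite mem_filter => /andP[et ut].
  have [c [c1 comm]] := even_edge_partner ut et; split.
  - exact/tperm_square/tu.
  - by rewrite (seq.permP ru).
  - exists c; split; first by rewrite mem_filter c1.
      by rewrite (seq.permP ru).
    by move=> q; rewrite (perm_mem ru) => /comm.
have {}RO : perm_eq R O.
  apply: (perm_trans RO); rewrite (perm_trans (perm_filter _ ru)) //.
  rewrite (eq_in_filter (a2 := fun t => odd (count_mem t u))) // => t ut.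
  by rewrite mem_filter ut andbT negbK.
have [|||||||p cp [g' E']] := @odd_tree_cycle_on _ M V R.
- by move=> m /nonsimple_odd/transposition_odd.
- exact: nonsimple_commute.
- by move=> t; rewrite (perm_mem RO) => /transposition_odd.
- by move=> t; rewrite (perm_mem RO) => /odd_fixed.
- move=> x y Vx Vy; apply: connect_sub (connected_V Vx Vy) => z w.
  by rewrite /edge -(perm_mem RO) => zw; apply: connect1.
- by move=> m; rewrite inE => /andP[_ om]; rewrite (seq.permP RO) count_odd.
- by rewrite (seq.permP RO) size_odd.
by exists p => //; exists (g' * g); rewrite E E' conjgM.
Qed.

Lemma rearrangement_conj r : perm_eq r u ->
  exists g, \prod_(p <- r) p = (\prod_(p <- u) p) ^ g.
Proof.
case/rearrangement_cycle_on=> p cp [g ->].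
have [q cq [h ->]] := rearrangement_cycle_on (perm_refl u).
have [k ->] := cycle_on_conj cp cq.
by exists (h^-1 * k * g); rewrite !conjgM conjgK.
Qed.

End Sufficiency.

(** * Bridges of trees and the equivalence *)

Section Tree.
Local Open Scope group_scope.
Variables (T : finType) (u : seq {perm T}).

Lemma tree_bridge : is_tree (edge u) ->
  forall x y, edge u x y -> ~~ connect (edge (del (tperm x y) u)) x y.
Proof.
case=> _ _ acyclic x y xy; apply/negP=> /connectP[s0 xs0 yE].
move: xs0 yE; case/shortenP=> s xs uxs _ yE.
have sub : subrel (edge (del (tperm x y) u)) (edge u).
  by move=> a b; rewrite /edge mem_del => /and3P[-> _ ->].
(* A simple path around the deleted edge closes up with it to a cycle. A path too short for that has
   no edge or is the deleted edge itself. *)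
have [|/acyclic] := leqP (size (x :: s)) 2; last first.
  apply; rewrite /ucycle; apply/andP; split=> //=.
  by rewrite rcons_path (sub_path sub xs) -yE edge_sym.
case: s xs uxs yE => [|z [|//]] /=.
  by move=> _ _ yE; case/andP: xy; rewrite yE eqxx.
by rewrite andbT => + _ yE; rewrite -yE /edge mem_del eqxx andbF.
Qed.

End Tree.

Theorem theorem3p13 (n : nat) (hn : 4 <= n) (u : seq 'S_n)
    (hu : forall p : 'S_n, p \in u -> is_transposition p)
    (htree : is_multitree (transpositional_multigraph u)) :
  conjugacy_invariant u <->
  (forall x : 'I_n,
     #|[set y | non_simple (transpositional_multigraph u) x y]| <= 1)
  /\
  (forall x y : 'I_n,
     0 < transpositional_multigraph u x y ->
     ~~ odd (transpositional_multigraph u x y) ->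
     (multitwig (transpositional_multigraph u) x y
      /\ #|neighbors (transpositional_multigraph u) y| = 2)
     \/
     (multitwig (transpositional_multigraph u) y x
      /\ #|neighbors (transpositional_multigraph u) x| = 2)).
Proof.
set m := transpositional_multigraph u in htree *.
have adjE : adjacent m =2 edge u.
  move=> x y; rewrite /adjacent /m /transpositional_multigraph /edge.
  by case: eqVneq => //= _; rewrite -has_count has_pred1.
have mE x y : edge u x y -> m x y = count_mem (tperm x y) u.
  by case/andP=> xy _; rewrite /m /transpositional_multigraph (negbTE xy).
have m_edge x y : 0 < m x y -> edge u x y by rewrite -adjE.
have nbE x y : (y \in neighbors m x) = edge u x y by rewrite inE adjE.
have tree : is_tree (edge u).
  case: htree => cT conn acyc; split=> // [x y|c /acyc nc /andP[cyc uc]].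
    by rewrite -(eq_connect adjE).
  by apply: nc; rewrite /ucycle (eq_cycle adjE) cyc.
have bridge := tree_bridge tree; case: tree => _ conn _.
have card_n : 4 <= #|'I_n| by rewrite card_ord.
have sym x y : edge u x y -> edge u y x by rewrite edge_sym.
split=> [ci|[simple even]].
  have inv : orbit_sum_invariant u.
    move=> r ru; have [g E] := ci (composite r) (ex_intro2 _ _ r ru erefl).
    by rewrite -[RHS](orbit_sum_conj _ g); congr orbit_sum; apply: E.
  have single := nonsimple_star hu conn bridge card_n inv.
  split=> [x|x y xy].
    rewrite leqNgt; apply/negP=> /card_gt1P[a [b []]]; rewrite !inE /non_simple.
    move=> xa xb ab; have [ea eb] := (m_edge _ _ (ltnW xa), m_edge _ _ (ltnW xb)).
    by move: xa xb; rewrite !mE // => xa; rewrite (single x a b).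
  have {xy}exy := m_edge _ _ xy; rewrite (mE _ _ exy) => ev.
  have twig v w : edge u v w -> ~~ odd (count_mem (tperm v w) u) ->
      (forall z, edge u v z -> z = w) ->
      multitwig m v w /\ #|neighbors m w| = 2.
    move=> vw ev' leaf_v; split.
      split; first by rewrite mE // edge_count.
      by apply/eqP/cards1P; exists w; apply/setP=> z; rewrite nbE inE;
         apply/idP/eqP=> [/leaf_v|->].
    (* A third vertex must be reached through [w], since [v] is a leaf; this supplies the second
       neighbor of [w]. *)
    have [z nz] : exists z, z \notin [set v; w].
      have : [set v; w] \proper [set: 'I_n].
        rewrite properEcard subsetT cardsT (leq_trans _ card_n) // cards2.
        by case: (v != w).
      by case/properP=> _ [z _ nz]; exists z.
    have [|a Aa [x' nAx ax]] := connect_exit (conn v z) _ nz; first by rewrite !inE eqxx.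
    have wx : edge u w x' /\ x' != v.
      move: Aa nAx; rewrite !inE negb_or => /orP[] /eqP aE /andP[xv xw]; rewrite aE in ax.
        by rewrite (leaf_v _ ax) eqxx in xw.
      by [].
    case: wx => wx xv.
    apply/eqP/cards2P; exists v, x'; split; first by rewrite eq_sym.
    apply/setP=> c; rewrite nbE !inE.
    apply/idP/orP=> [wc|[] /eqP -> //]; last exact: sym.
    have [->|cv] := eqVneq c v; first by left.
    right; apply/eqP; exact: (even_twig_center hu conn bridge card_n inv vw ev' leaf_v).
  (* If [x] has another neighbor, [even_edge_end] makes [y] the leaf; otherwise [x] is one. *)
  have [/existsP[z /andP[xz zy]]|nx] := boolP [exists z, edge u x z && (z != y)].
    right; apply: twig; [exact: sym|by rewrite tpermC|].
    move=> w yw; apply/eqP; apply: contraT => wx.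
    by case: (even_edge_end hu conn bridge card_n inv exy ev xz zy yw wx).
  left; apply: twig => // z xz; apply/eqP; apply: contraT => zy.
  by case/existsP: nx; exists z; rewrite xz.
move=> p [r ru ->]; have ex0 : 0 < n by apply: leq_trans hn.
apply: (@rearrangement_conj _ u hu conn bridge (Ordinal ex0)) => //.
  move=> w a b wa wb a1 b1; apply: (card_le1_eqP (simple w)).
    by rewrite inE /non_simple mE.
  by rewrite inE /non_simple mE.
have twig v w : multitwig m v w /\ #|neighbors m w| = 2 -> thin_twig u v w.
  move=> [[vw /eqP/cards1P[z zE]] /eqP/cards2P[a [b [ab wE]]]]; split.
  - exact: m_edge.
  - move=> y; rewrite -nbE zE inE => /eqP ->; symmetry; apply/eqP.
    by rewrite -in_set1 -zE nbE m_edge.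
  - have : v \in neighbors m w by rewrite nbE sym // m_edge.
    rewrite wE !inE => /orP[] /eqP vE.
      exists b; split; first by rewrite vE eq_sym.
        by rewrite -nbE wE !inE eqxx orbT.
      by move=> y; rewrite -nbE wE !inE vE => /orP[] /eqP; [left|right].
    exists a; split; first by rewrite vE.
      by rewrite -nbE wE !inE eqxx.
    by move=> y; rewrite -nbE wE !inE vE => /orP[] /eqP; [right|left].
move=> v w vw ev.
by case: (even v w); rewrite ?mE ?edge_count //; [left|right]; apply: twig.
Qed.
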